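(* Let $a\in(0,1)$, let $\Gamma\subset\mathbb{R}^2$ be a regular $C^{1,\alpha}$-smooth planar curve without self-intersections, and let $\mu_a$ be the unique minimizer of $$I[\mu]=\int\int\log\frac1{|x-y|}\,d\mu(x)\,d\mu(y)+\int|x|^2\,d\mu(x)$$ over the set $\mathcal{M}_a$ of all probability measures $\mu$ on $\mathbb{R}^2$ with $\mu(\Gamma)\ge a$. Then $$\operatorname{dist}\bigl(\Gamma,\ \operatorname{supp}\mu_a\setminus\Gamma\bigr)>0.$$
   Context: Here $\Gamma$ is a regular curve in $\mathbb{R}^2$ with locally finite length, and by abuse of notation $\Gamma:\mathbb{R}\to\mathbb{R}^2$ also denotes its arc-length parametrization, $|\dot\Gamma(t)|=1$ for $t\in\mathbb{R}$; $C^{1,\alpha}$ means that $\dot\Gamma$ is Hölder continuous with some exponent $\alpha\in(0,1)$. For sets $A,B$, $\operatorname{dist}(A,B)=\inf\{|x-y|:x\in A,\ y\in B\}$. All measures are Borel measures. *)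

(* Defs.v *)
From HB Require Import structures.
From mathcomp Require Import all_boot all_order all_algebra.
From mathcomp Require Import all_classical all_reals all_analysis.

Set Implicit Arguments.
Unset Strict Implicit.
Unset Printing Implicit Defensive.

Import Order.TTheory GRing.Theory Num.Theory.
Import numFieldNormedType.Exports.

Local Open Scope classical_set_scope.
Local Open Scope ring_scope.

(* The plane is [R * R]: its product topology is the Euclidean one and its
   product sigma-algebra is the Borel one, but its library norm is the sup
   norm, hence the explicit Euclidean norm below. *)
Definition euclid (R : realType) (x : R * R) : R :=
  Num.sqrt (x.1 ^+ 2 + x.2 ^+ 2).

(* The infimum is taken in [\bar R], so the distance to the empty set is +oo. *)
Definition dist (R : realType) (A B : set (R * R)) : \bar R :=
  ereal_inf [set (euclid (x - y))%:E | x in A & y in B].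

Definition arc_length_parametrized (R : realType) (G : R -> R * R) : Prop :=
  forall t, derivable G t 1 /\ euclid (derive1 G t) = 1.

Definition C1_holder (R : realType) (alpha : R) (G : R -> R * R) : Prop :=
  (forall t, derivable G t 1) /\
  exists C : R, forall s t,
    euclid (derive1 G s - derive1 G t) <= C * `|s - t| `^ alpha.

(* A simple open curve has an injective parametrization; a simple closed curve
   is parametrized periodically over the line, and then a point is revisited
   only after a period. The condition covers exactly these two cases (injective
   curves are those for which it holds with [s = t] only). *)
Definition no_self_intersection (R : realType) (G : R -> R * R) : Prop :=
  forall s t, G s = G t -> forall u, G (u + (t - s)) = G u.

(* Length of the part of the curve lying in [K], for an arc-length
   parametrization: the measure of the parameters, where each point is counted
   once (for an injective [G] it is the Lebesgue measure of [G @^-1` K]). *)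
Definition length_in (R : realType) (G : R -> R * R) (K : set (R * R)) :
    \bar R :=
  ereal_sup [set lebesgue_measure E | E in
    [set E : set R | [/\ measurable E, {in E &, injective G}
                       & E `<=` G @^-1` K]]].

Definition locally_finite_length (R : realType) (G : R -> R * R) : Prop :=
  forall K : set (R * R), compact K -> (length_in G K < +oo)%E.

(* [x%:E^-1] is +oo at [x = 0], so the kernel is +oo on the diagonal.
   The outer sum is the dual addition, for which +oo - oo = +oo: the double
   integral is well defined in ]-oo, +oo] when the second moment is finite, and
   the energy is +oo when the second moment is infinite. With the default
   addition, heavy-tailed measures would get the energy -oo. *)
Definition log_energy (R : realType) (mu : probability (R * R)%type R) :
    \bar R :=
  dual_adde
    (\int[mu]_x \int[mu]_y lne ((euclid (x - y))%:E^-1))%E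
    (\int[mu]_x (euclid x ^+ 2)%:E)%E.

Definition constrained_measures (R : realType) (S : set (R * R)) (a : R) :
    set (probability (R * R)%type R) :=
  [set mu | (a%:E <= mu S)%E].

Definition is_minimizer (R : realType) (T : Type) (I : T -> \bar R)
    (M : set T) (mu : T) : Prop :=
  M mu /\ forall nu, M nu -> (I mu <= I nu)%E.

Definition supp (R : realType) (mu : probability (R * R)%type R) :
    set (R * R) :=
  [set x | forall U : set (R * R), open U -> U x -> (0 < mu U)%E].

(* Main.v *)
Require Import Defs.
From HB Require Import structures.
From mathcomp Require Import all_boot all_order all_algebra.
From mathcomp Require Import all_classical all_reals all_analysis.
From mathcomp Require Import measurable_realfun ring lra.
Import Order.TTheory GRing.Theory Num.Theory.
Import numFieldNormedType.Exports.
Local Open Scope classical_set_scope.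
Local Open Scope ring_scope.

(** Write K(x,y) = log 1/|x-y| + (|x|^2+|y|^2)/2, which is nonnegative, and
    P(x) = \int K(x,y) dmu(y) for the potential of the minimizer mu.  When the
    second moment is finite the energy is the quadratic form of K, so half its
    derivative at mu in the direction sigma - mu is \int P dsigma - \int P dmu.

    Moving the mass of a set A onto a probability sigma of finite energy is
    admissible as soon as A misses the curve Gamma or sigma lives on Gamma, and
    minimality then gives
       \int_A P dmu <= mu(A) \int P dsigma             ([first_variation]).
    It is enough to use for sigma the uniform measures carried by short arcs:
    arcs of Gamma and line segments ([arc_variation]).

    The heart of the proof is a gap ([curve_potential_gap]): for every x0 on
    Gamma some constant k < P(x0) satisfies \int_A P dmu <= k mu(A) for all A
    off Gamma.  Suppose not.  Then P(x0) <= \int P dsigma for all segment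
    measures sigma.  Arcs of Gamma that shrink to x0 give
    \int_A P dmu <= mu(A) P(x0) for every A ([point_variation]), so
    P <= P(x0) mu-almost everywhere: mu-almost every x is a point where P is at
    most its mean over any segment, and so at most its means around x at all
    scales.  But log 1/|x-y| is superharmonic, and strictly so where mu has
    mass: the mean of P around x at scale r is at most
    P(x) - c mu(B(x,r/2)) + O(r^2) ([submean]).  Hence mu(B(x,r)) = O(r^2) for mu-almost every x
    ([small_density]), and such a measure does not charge a rectifiable curve
    ([null_curve]), against mu(Gamma) >= a > 0.

    Given the gap, P is lower semicontinuous ([potential_lsc]), so P > k' > k
    near x0 and mu has no mass off Gamma there; P also grows at infinity, so
    the part of the support off Gamma is bounded.  As Gamma is closed
    ([closed_range]), compactness turns this local separation into a positive
    distance ([uniform_separation]).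

    The mean value inequality is obtained without polar coordinates: the circle
    is replaced by a regular 2^k-gon, on which the product of the distances to
    z is |z^n - s^n|, and the singularities are smoothed by averaging over the
    radius s in [r, 2r].  The error is O(1/n). *)

Set Implicit Arguments.
Unset Strict Implicit.
Unset Printing Implicit Defensive.

(** * The Euclidean plane and the energy kernel *)

Section plane.
Variable R : realType.
Implicit Types (x y z : R * R) (u v : R).

Definition sqnorm x : R := x.1 ^+ 2 + x.2 ^+ 2.

Lemma sqnorm_ge0 x : 0 <= sqnorm x.
Proof. by rewrite addr_ge0 ?sqr_ge0. Qed.

Lemma euclid_ge0 x : 0 <= euclid x.
Proof. exact: sqrtr_ge0. Qed.

Lemma sqr_euclid x : euclid x ^+ 2 = sqnorm x.
Proof. by rewrite sqr_sqrtr// sqnorm_ge0. Qed.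

Lemma euclidC x y : euclid (x - y) = euclid (y - x).
Proof.
by congr Num.sqrt; rewrite /= -(sqrrN (x.1 - y.1)) -(sqrrN (x.2 - y.2)) !opprB.
Qed.

Lemma euclid0 : euclid (0 : R * R) = 0.
Proof. by rewrite /euclid /= expr0n /= addr0 sqrtr0. Qed.

Definition dot (u v : R * R) := u.1 * v.1 + u.2 * v.2.

Lemma dot_le (u v : R * R) : `|dot u v| <= euclid u * euclid v.
Proof.
rewrite -(@ler_pXn2r _ 2)// ?nnegrE ?mulr_ge0 ?euclid_ge0//.
rewrite real_normK ?num_real// exprMn !sqr_euclid /sqnorm /dot.
have := sqr_ge0 (u.1 * v.2 - u.2 * v.1).
by rewrite -subr_ge0; congr (_ <= _); ring.
Qed.

Lemma ler_euclidD x y : euclid (x + y) <= euclid x + euclid y.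
Proof.
rewrite -(@ler_pXn2r _ 2)// ?nnegrE ?addr_ge0 ?euclid_ge0//.
rewrite sqrrD !sqr_euclid.
have h := le_trans (ler_norm _) (dot_le x y).
rewrite /sqnorm /= -subr_ge0.
rewrite (_ : _ - _ = 2 * (euclid x * euclid y - dot x y)).
  by rewrite mulr_ge0// subr_ge0.
by rewrite /dot; ring.
Qed.

Lemma euclid_triangle z x y : euclid (x - y) <= euclid (x - z) + euclid (z - y).
Proof.
by have -> : x - y = (x - z) + (z - y); [rewrite addrA subrK|exact: ler_euclidD].
Qed.

Lemma euclid_fst x : `|x.1| <= euclid x.
Proof.
rewrite -(@ler_pXn2r _ 2)// ?nnegrE ?euclid_ge0//.
by rewrite real_normK ?num_real// sqr_euclid lerDl sqr_ge0.
Qed.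

Lemma euclid_snd x : `|x.2| <= euclid x.
Proof.
rewrite -(@ler_pXn2r _ 2)// ?nnegrE ?euclid_ge0//.
by rewrite real_normK ?num_real// sqr_euclid lerDr sqr_ge0.
Qed.

Lemma euclid_le x : euclid x <= `|x.1| + `|x.2|.
Proof.
rewrite -(@ler_pXn2r _ 2)// ?nnegrE ?euclid_ge0 ?addr_ge0//.
rewrite sqr_euclid sqrrD !real_normK ?num_real// /sqnorm.
by rewrite -addrA (addrC (_ *+ 2)) addrA lerDl mulrn_wge0// mulr_ge0.
Qed.

(** log (1/u), with value +oo at 0; the radial profile of the kernel in the
    definition of the energy. *)
Definition neglog u : \bar R := lne (u%:E^-1)%E.

Lemma neglog0 : neglog 0 = +oo%E.
Proof. by rewrite /neglog inve0. Qed.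

Lemma neglogE u : 0 < u -> neglog u = (- ln u)%:E.
Proof.
by move=> u0; rewrite /neglog inver gt_eqF// lne_EFin ?invr_gt0// lnV ?posrE.
Qed.

Lemma le_neglog u v : 0 <= u -> u <= v -> (neglog v <= neglog u)%E.
Proof.
rewrite le_eqVlt => /predU1P[<-|u0 uv]; first by rewrite neglog0 leey.
by rewrite !neglogE ?(lt_le_trans u0)// lee_fin lerN2 ler_ln ?posrE ?(lt_le_trans u0).
Qed.

(** Spreading the confinement |x|^2 symmetrically over the two variables makes
    the kernel nonnegative, so that no integrability condition is needed to
    exchange or to add its integrals. *)
Definition logkernel x y : \bar R :=
  (neglog (euclid (x - y)%R) + ((sqnorm x + sqnorm y) / 2)%:E)%E.

Lemma logkernelC x y : logkernel x y = logkernel y x.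
Proof. by rewrite /logkernel euclidC (addrC (sqnorm x)). Qed.

Lemma sqnormB_le x y : sqnorm (x - y) <= 2 * (sqnorm x + sqnorm y).
Proof.
rewrite /sqnorm /= -subr_ge0.
rewrite (_ : _ - _ = (x.1 + y.1) ^+ 2 + (x.2 + y.2) ^+ 2); last by ring.
by rewrite addr_ge0 ?sqr_ge0.
Qed.

Lemma ln_le_subr1 u : 0 < u -> ln u <= u - 1.
Proof.
by move=> u0; have := @le_ln1Dx R (u - 1); rewrite (addrC 1) subrK; apply; lra.
Qed.

(** From |x-y|^2 <= 2 (|x|^2+|y|^2) and ln t <= t - 1, the latter applied to
    t = k (|x|^2+|y|^2).  With k = 1 this makes the kernel below nonnegative;
    with k = 1/2 half of the quadratic term is left over, which is the growth
    of the potential at infinity. *)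
Lemma neglog_ge x y (k : R) : 0 < k ->
  ((- (k * (sqnorm x + sqnorm y) - 1 - ln k + ln 2) / 2)%:E
   <= neglog (euclid (x - y)%R))%E.
Proof.
move=> k0; have := euclid_ge0 (x - y); rewrite le_eqVlt => /predU1P[<-|e0].
  by rewrite neglog0 leey.
rewrite neglogE// lee_fin mulNr lerN2 ler_pdivlMr//.
rewrite mulr_natr -lnXn// sqr_euclid.
have s0 : 0 < sqnorm (x - y) by rewrite -sqr_euclid exprn_gt0.
have t0 : 0 < sqnorm x + sqnorm y.
  by have := lt_le_trans s0 (sqnormB_le x y); rewrite pmulr_rgt0.
apply: (@le_trans _ _ (ln (2 * (sqnorm x + sqnorm y)))).
  by rewrite ler_ln ?posrE ?sqnormB_le// mulr_gt0.
rewrite lnM ?posrE//.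
have := @ln_le_subr1 (k * (sqnorm x + sqnorm y)); rewrite lnM ?posrE// mulr_gt0//.
by move=> /(_ isT); lra.
Qed.

Lemma ln2_lt1 : ln 2 <= (1 : R).
Proof. by have := @ln_le_subr1 2 ltac:(by []); lra. Qed.

Lemma logkernel_ge0 x y : (0 <= logkernel x y)%E.
Proof.
have := @neglog_ge x y 1 ltr01; rewrite ln1 => h.
apply: (@le_trans _ _ ((- (1 * (sqnorm x + sqnorm y) - 1 - 0 + ln 2) / 2)%:E + ((sqnorm x + sqnorm y) / 2)%:E)%E).
  by rewrite -EFinD lee_fin; have := ln2_lt1; lra.
by rewrite leeD2r.
Qed.

Lemma logkernel_ge_sqnorm x y : ((sqnorm x / 4 - 1)%:E <= logkernel x y)%E.
Proof.
have := @neglog_ge x y 2^-1; rewrite invr_gt0 ltr0n lnV ?posrE// => /(_ isT) h.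
apply: (le_trans _ (leeD2r _ h)).
rewrite -EFinD lee_fin; have := ln2_lt1; have := sqnorm_ge0 y; lra.
Qed.

Lemma neglog_le_logkernel x y : (neglog (euclid (x - y)%R) <= logkernel x y)%E.
Proof.
by rewrite leeDl// lee_fin divr_ge0// addr_ge0// sqnorm_ge0.
Qed.

End plane.

(** * Measurability of the kernel *)

Section measurability.
Variable R : realType.
Local Notation plane := (R * R)%type.

Lemma measurable_neglog : measurable_fun setT (@neglog R).
Proof.
rewrite (_ : @neglog R = fun u => if u == 0 then +oo%E else
  if u < 0 then -oo%E else (- ln u)%:E); last first.
  apply/funext => u; case: ltgtP => [u0|u0|->]; last exact: neglog0.
    by rewrite /neglog inver lt_eqF// le0_lneNy// lee_fin invr_le0 ltW.
  exact: neglogE.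
apply: measurable_fun_ifT => //; first exact: measurable_fun_eqr.
apply: measurable_fun_ifT => //; first exact: measurable_fun_ltr.
by apply/measurable_EFinP/measurable_funN; exact: measurable_ln.
Qed.

Lemma measurable_ltr_indic d (T : measurableType d) (f : T -> R) (c : R) :
  measurable_fun setT f -> measurable_fun setT (fun t => (f t < c)%R%:R : R).
Proof.
move=> mf; rewrite (_ : (fun t => _) = fun t => if f t < c then 1 else 0).
  by apply: measurable_fun_ifT => //; exact: measurable_fun_ltr.
by apply/funext => t; case: ifPn.
Qed.

Lemma measurable_sqnorm : measurable_fun setT (@sqnorm R).
Proof.
by apply: measurable_funD; apply: measurable_funX;
  [exact: measurable_fst|exact: measurable_snd].
Qed.

Lemma measurable_euclid : measurable_fun setT (@euclid R).
Proof.
apply: measurableT_comp; last exact: measurable_sqnorm.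
by apply: continuous_measurable_fun; exact: sqrt_continuous.
Qed.

Lemma measurable_euclidB d (T : measurableType d) (f g : T -> plane) :
  measurable_fun setT f -> measurable_fun setT g ->
  measurable_fun setT (fun t => euclid (f t - g t)).
Proof.
move=> /measurable_fun_pairP[f1 f2] /measurable_fun_pairP[g1 g2].
apply: measurableT_comp; first exact: measurable_euclid.
by apply/measurable_fun_pairP; split; exact: measurable_funB.
Qed.

Lemma measurable_logkernel d (T : measurableType d) (f g : T -> plane) :
  measurable_fun setT f -> measurable_fun setT g ->
  measurable_fun setT (fun t => logkernel (f t) (g t)).
Proof.
move=> mf mg; apply: emeasurable_funD.
  apply: measurableT_comp; first exact: measurable_neglog.
  exact: measurable_euclidB.
apply/measurable_EFinP; apply: measurable_funM => //.
by apply: measurable_funD; apply: measurableT_comp => //; exact: measurable_sqnorm.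
Qed.

End measurability.

(** * Integrability of the logarithmic singularity along curves *)

Section dyadic_count.
Variable R : realType.
Implicit Types (e u c : R).

(** The number of dyadic scales e, e/2, e/4, ... above u: a majorant of
    log (e/u), up to an additive constant, that is a sum of indicators and so
    can be integrated term by term. *)
Definition dyadic_count e u : \bar R :=
  \sum_(k <oo) ((u < e / 2 ^+ k)%R%:R)%:E.

Lemma dyadic_count_ge0 e u : (0 <= dyadic_count e u)%E.
Proof. by apply: nneseries_ge0 => k _ _; rewrite lee_fin. Qed.

Lemma dyadic_count_ge e u (N : nat) :
  (forall k, (k < N)%N -> u < e / 2 ^+ k) -> (N%:R%:E <= dyadic_count e u)%E.
Proof.
move=> uN; apply: (le_trans _ (nneseries_lim_ge N _)); last first.
  by move=> k _ _; rewrite lee_fin.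
rewrite sumEFin lee_fin (eq_big_nat _ _ (F2 := fun=> 1)); last first.
  by move=> k /andP[_ kN]; rewrite uN.
by rewrite sumr_const_nat subn0.
Qed.

Lemma dyadic_count0 e : 0 < e -> dyadic_count e 0 = +oo%E.
Proof.
move=> e0; apply/eqyP => A A0.
apply: (@le_trans _ _ ((Num.truncn A).+1%:R%:E)).
  by rewrite lee_fin ltW// truncnS_gt.
by apply: dyadic_count_ge => k _; rewrite divr_gt0// exprn_gt0.
Qed.

(** If u lies in [e/2^N, e/2^(N-1)[ then ln (e/u) <= N ln 2 <= N, and N scales
    are above u. *)
Lemma neglog_le_dyadic_count e u : 0 < e -> 0 <= u ->
  (neglog u <= (- ln e)%:E + dyadic_count e u)%E.
Proof.
move=> e0; rewrite le_eqVlt => /predU1P[<-|u0].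
  by rewrite dyadic_count0// addey// leey.
have [N eN] : exists N, e / 2 ^+ N <= u.
  have [N hN] : exists N : nat, e / u <= N%:R.
    by exists (Num.truncn (e / u)).+1; exact/ltW/truncnS_gt.
  exists N; rewrite ler_pdivrMr ?exprn_gt0// mulrC -ler_pdivrMr//.
  by rewrite (le_trans hN)// -natrX ler_nat ltnW// ltn_expl.
pose M := ex_minn (ex_intro (fun N => e / 2 ^+ N <= u) N eN).
have hM : e / 2 ^+ M <= u by rewrite /M; case: ex_minnP.
have hM' k : (k < M)%N -> u < e / 2 ^+ k.
  rewrite /M; case: ex_minnP => m _ hm; rewrite ltnNge ltNge.
  by apply: contra => /hm.
apply: (@le_trans _ _ ((- ln e)%:E + M%:R%:E)%E); last first.
  by rewrite leeD2l// dyadic_count_ge.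
rewrite neglogE// -EFinD lee_fin lerNl opprD opprK.
have h : ln (e / 2 ^+ M) <= ln u by rewrite ler_ln// posrE divr_gt0// exprn_gt0.
apply: le_trans h; rewrite lnM ?posrE ?invr_gt0 ?exprn_gt0//.
rewrite lnV ?posrE ?exprn_gt0// lnXn// lerD2l lerN2 -[leLHS]mulr_natr.
by rewrite ler_piMl// ln2_lt1.
Qed.

Lemma measurable_dyadic_count e d (T : measurableType d) (f : T -> R) :
  measurable_fun setT f -> measurable_fun setT (dyadic_count e \o f).
Proof.
move=> mf; apply: ge0_emeasurable_sum => [k x _ _|k _]; first by rewrite lee_fin.
by apply/measurable_EFinP; exact: measurable_ltr_indic.
Qed.

(** If f s and f t are both below eta then |s - t| < 2 eta / c: the set lies in
    an interval of length 4 eta / c around any of its points.  The hypothesis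
    is what the triangle inequality gives when f is the distance from a fixed
    point to a curve that does not contract distances by more than c. *)
Lemma measure_sublevel_le (f : R -> R) c a b eta :
  0 < c -> 0 < eta -> measurable_fun setT f ->
  {in `[a, b] &, forall s t, c * `|s - t| <= f s + f t} ->
  (\int[lebesgue_measure]_(t in `[a, b]) ((f t < eta)%R%:R)%:E
   <= (4 * eta / c)%:E)%E.
Proof.
move=> c0 eta0 mf hf.
pose B := [set t | f t < eta].
have mB : measurable B.
  rewrite (_ : B = f @^-1` `]-oo, eta[%classic).
    by rewrite -[X in measurable X]setTI; exact: mf.
  by apply/seteqP; split=> t /=; rewrite in_itv.
have -> : (\int[lebesgue_measure]_(t in `[a, b]) ((f t < eta)%R%:R)%:E =
           \int[lebesgue_measure]_(t in `[a, b]) (\1_B t)%:E)%E.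
  apply: eq_integral => t _; rewrite indicE; congr (_ _)%:R%:E.
  by apply/idP/idP; rewrite inE.
rewrite integral_indic//.
have [->|/set0P[t0 [ft0 t0ab]]] := eqVneq (B `&` `[a, b]) set0.
  by rewrite measure0 lee_fin ltW// divr_gt0// mulr_gt0.
apply: (@le_trans _ _ (lebesgue_measure `[t0 - 2 * eta / c, t0 + 2 * eta / c])).
  apply: le_measure; rewrite ?inE//; first exact: measurableI.
  move=> t [ft tab] /=.
  rewrite in_itv/= -ler_distlC ler_pdivlMr// mulrC.
  rewrite (le_trans (hf _ _ t0ab tab))// mulr_natl mulr2n ltW// ltrD//.
have h : 0 < eta / c by rewrite divr_gt0.
rewrite lebesgue_measure_itv/= lte_fin ifT -?EFinD ?lee_fin; lra.
Qed.

Lemma integral_dyadic_count (f : R -> R) c a b e :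
  0 < c -> 0 < e -> measurable_fun setT f ->
  {in `[a, b] &, forall s t, c * `|s - t| <= f s + f t} ->
  (\int[lebesgue_measure]_(t in `[a, b]) dyadic_count e (f t)
   <= (8 * e / c)%:E)%E.
Proof.
move=> c0 e0 mf hf; rewrite /dyadic_count integral_nneseries//; last first.
  move=> k; apply: measurable_funTS.
  by apply/measurable_EFinP; exact: measurable_ltr_indic.
have h : 0 <= 8 * e / c by rewrite ltW// divr_gt0// mulr_gt0.
apply: (le_trans _ (epsilon_trick0 xpredT h)).
apply: lee_nneseries => [k _ _|k _].
  by apply: integral_ge0 => t _; rewrite lee_fin.
have e2 : 0 < e / 2 ^+ k by rewrite divr_gt0// exprn_gt0.
apply: (le_trans (measure_sublevel_le c0 e2 mf hf)).
rewrite lee_fin natrX exprS le_eqVlt; apply/orP; left; apply/eqP.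
have := lt0r_neq0 c0; have : (2 ^+ k : R) != 0 by rewrite expf_neq0.
by move: (2 ^+ k) => z z0 c0'; field; rewrite z0.
Qed.

End dyadic_count.

(** * Two integration lemmas *)

Section measure_lemmas.
Local Open Scope ereal_scope.
Context d (T : measurableType d) (R : realType).

(** The minuend is allowed to have an infinite integral: energies may be
    infinite, and only the subtracted quadratic term is known to be
    integrable. *)
Lemma ge0_integralB (m : {measure set T -> \bar R}) (h : T -> \bar R) (g : T -> R) :
  measurable_fun setT h -> measurable_fun setT g ->
  (forall x, 0 <= h x) -> (forall x, 0 <= g x)%R ->
  \int[m]_x (g x)%:E < +oo ->
  \int[m]_x (h x - (g x)%:E) = \int[m]_x h x - \int[m]_x (g x)%:E.
Proof.
move=> mh mg h0 g0 goo.
have mgE : measurable_fun setT (EFin \o g) by exact/measurable_EFinP.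
have ig : m.-integrable setT (EFin \o g).
  apply/integrableP; split => //.
  by under eq_integral do rewrite gee0_abs ?lee_fin//.
have [hoo|] := ltP (\int[m]_x h x) +oo.
  rewrite (@integralB _ _ _ m setT measurableT h (EFin \o g))//.
  apply/integrableP; split => //.
  by under eq_integral do rewrite gee0_abs ?lee_fin//.
rewrite leye_eq => /eqP hoo; rewrite hoo.
have gfin : \int[m]_x (g x)%:E \is a fin_num.
  by rewrite ge0_fin_numE// integral_ge0// => x _; rewrite lee_fin.
rewrite -(fineK gfin) -EFinN addye//.
pose f := h \- (EFin \o g).
have mf : measurable_fun setT f by exact: emeasurable_funB.
rewrite -/f integralE.
have fn : \int[m]_x (f^\- x) <= \int[m]_x (g x)%:E.
  apply: ge0_le_integral => //; first exact: measurable_funeneg.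
  move=> x _; rewrite funenegE /f /=.
  rewrite ge_max lee_fin g0 andbT.
  case: (h x) (h0 x) => [r| |] //=; last by rewrite leNye.
  by rewrite !lee_fin => r0; lra.
have fp : \int[m]_x f^\+ x = +oo.
  have : +oo <= \int[m]_x f^\+ x + \int[m]_x (g x)%:E.
    rewrite -hoo -ge0_integralD//; [|exact: measurable_funepos|].
      apply: ge0_le_integral => //.
        by apply: emeasurable_funD => //; exact: measurable_funepos.
      by move=> x _; rewrite funeposE /f /= -leeBlDr// le_max lexx.
    by move=> x _; rewrite lee_fin.
  rewrite leye_eq -(fineK gfin); case: (\int[m]_x f^\+ x) => //.
rewrite fp; have : \int[m]_x f^\- x < +oo by apply: le_lt_trans fn _.
have : 0 <= \int[m]_x f^\- x by apply: integral_ge0.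
by case: (\int[m]_x f^\- x).
Qed.

Lemma integral_mrestr (m : {measure set T -> \bar R}) A (mA : measurable A)
  (f : T -> \bar R) : measurable_fun setT f -> (forall x, 0 <= f x) ->
  \int[mrestr m mA]_x f x = \int[m]_(x in A) f x.
Proof.
move=> mf f0.
have mC : measurable (~` A) by exact: measurableC.
rewrite -(setUv A) (@ge0_integral_setU _ _ _ (mrestr m mA) A (~` A))//; last 2 first.
- exact: measurable_funTS.
- by apply/disj_setPS; rewrite setICr.
rewrite (@eq_measure_integral _ _ _ A m (mrestr m mA))/=; last first.
  by move=> B mB BA; rewrite /mrestr setIidl.
rewrite (@ge0_negligible_integral _ _ _ (mrestr m mA) (~` A) (~` A))//.
- by rewrite setDv integral_set0 adde0.
- exact: measurable_funTS.
- by rewrite /= /mrestr setICl measure0.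
Qed.

End measure_lemmas.

(** * Potentials, mutual energy, and the energy as a quadratic form *)

Section potential.
Local Open Scope ereal_scope.
Variable R : realType.
Local Notation plane := (R * R)%type.
Implicit Types m : {finite_measure set plane -> \bar R}.

Definition potential (m : set plane -> \bar R) (x : plane) : \bar R :=
  \int[m]_y logkernel x y.

(** Mutual energy of two measures. *)
Definition pairing (m1 m2 : set plane -> \bar R) : \bar R :=
  \int[m1]_x potential m2 x.

Lemma potential_ge0 m x : 0 <= potential m x.
Proof. by apply: integral_ge0 => y _; exact: logkernel_ge0. Qed.

Lemma measurable_logkernel2 :
  measurable_fun setT (fun z : plane * plane => logkernel z.1 z.2).
Proof. exact: measurable_logkernel. Qed.

Lemma measurable_potential m : measurable_fun setT (potential m).
Proof.
by apply: (measurable_fun_fubini_tonelli_F (fun z : plane * plane => logkernel z.1 z.2));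
  [exact: measurable_logkernel2|move=> z; exact: logkernel_ge0].
Qed.

Lemma pairing_ge0 m1 m2 : 0 <= pairing m1 m2.
Proof. by apply: integral_ge0 => y _; exact: potential_ge0. Qed.

Lemma pairingC m1 m2 : pairing m1 m2 = pairing m2 m1.
Proof.
rewrite /pairing /potential.
rewrite (fubini_tonelli (fun z : plane * plane => logkernel z.1 z.2))/=.
- by apply: eq_integral => x _; apply: eq_integral => y _; rewrite logkernelC.
- exact: measurable_logkernel2.
- by move=> z; exact: logkernel_ge0.
Qed.

Definition moment2 (m : set plane -> \bar R) := \int[m]_x (sqnorm x)%:E.

Lemma moment2_ge0 m : 0 <= moment2 m.
Proof. by apply: integral_ge0 => y _; rewrite lee_fin sqnorm_ge0. Qed.

Lemma integral_cst_probability (m : probability plane R) (c : \bar R) :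
  0 <= c -> \int[m]_x c = c.
Proof.
move=> c0; rewrite (@integral_cst _ _ _ m setT)//.
by rewrite -[RHS]mule1; congr (_ * _); exact: probability_setT.
Qed.

(** Subtracting the confinement from the kernel costs one second moment, which
    is exactly the confinement term that the energy adds back. *)
Lemma log_energyE (m : probability plane R) : moment2 m < +oo ->
  log_energy m = pairing m m.
Proof.
move=> m2oo.
have m2fin : moment2 m \is a fin_num by rewrite ge0_fin_numE// moment2_ge0.
have mq : measurable_fun setT (EFin \o @sqnorm R).
  by apply/measurable_EFinP; exact: measurable_sqnorm.
have inner x : \int[m]_y lne ((euclid (x - y)%R)%:E^-1) =
    potential m x - ((sqnorm x + fine (moment2 m)) / 2)%:E.
  transitivity (\int[m]_y (logkernel x y - ((sqnorm x + sqnorm y) / 2)%:E)).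
    by apply: eq_integral => y _; rewrite /logkernel addeK.
  have e : \int[m]_y ((sqnorm x + sqnorm y) / 2)%:E =
      ((sqnorm x + fine (moment2 m)) / 2)%:E.
    transitivity (\int[m]_y ((2^-1)%:E * ((sqnorm x)%:E + (sqnorm y)%:E))).
      by apply: eq_integral => y _; rewrite -EFinD -EFinM mulrC.
    rewrite ge0_integralZl//; last 2 first.
    - by apply: emeasurable_funD.
    - by move=> y _; rewrite -EFinD lee_fin addr_ge0// sqnorm_ge0.
    rewrite ge0_integralD//; last 2 first.
    - by move=> y _; rewrite lee_fin sqnorm_ge0.
    - by move=> y _; rewrite lee_fin sqnorm_ge0.
    rewrite integral_cst_probability ?lee_fin ?sqnorm_ge0// -/(moment2 m) -(fineK m2fin).
    by rewrite -EFinD -EFinM mulrC.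
  rewrite ge0_integralB//.
  - by rewrite e.
  - exact: measurable_logkernel.
  - by apply: measurable_funM => //; apply: measurable_funD => //; exact: measurable_sqnorm.
  - by move=> y; exact: logkernel_ge0.
  - by move=> y; rewrite divr_ge0// addr_ge0// sqnorm_ge0.
  - by rewrite e ltry.
rewrite /log_energy (_ : \int[m]_x (euclid x ^+ 2)%:E = moment2 m); last first.
  by apply: eq_integral => x _; rewrite sqr_euclid.
under eq_integral => x _ do rewrite inner.
have e : \int[m]_x ((sqnorm x + fine (moment2 m)) / 2)%:E = moment2 m.
  transitivity (\int[m]_y ((2^-1)%:E * ((sqnorm y)%:E + moment2 m))).
    by apply: eq_integral => y _; rewrite -{2}(fineK m2fin) -EFinD -EFinM mulrC.
  rewrite ge0_integralZl//; last 2 first.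
  - by apply: emeasurable_funD.
  - by move=> y _; rewrite adde_ge0 ?moment2_ge0// lee_fin sqnorm_ge0.
  rewrite ge0_integralD//; last 2 first.
  - by move=> y _; rewrite lee_fin sqnorm_ge0.
  - by move=> y _; exact: moment2_ge0.
  rewrite integral_cst_probability ?moment2_ge0// -/(moment2 m).
  rewrite -(fineK m2fin) -EFinD -EFinM/=; congr EFin; lra.
rewrite ge0_integralB//.
- rewrite e -/(pairing m m) -(fineK m2fin).
  have := pairing_ge0 m m; case: (pairing m m) => // r _.
  by rewrite -EFinN -EFinD /dual_adde/= subrK.
- exact: measurable_potential.
- by apply: measurable_funM => //; apply: measurable_funD => //; exact: measurable_sqnorm.
- exact: potential_ge0.
- by move=> y; rewrite divr_ge0// addr_ge0// ?sqnorm_ge0// fine_ge0 ?moment2_ge0.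
- by rewrite e.
Qed.

(** The energy adds with +oo - oo = +oo, so an infinite second moment makes it
    infinite. *)
Lemma log_energy_moment2 (m : probability plane R) :
  log_energy m < +oo -> moment2 m < +oo.
Proof.
rewrite /log_energy (_ : \int[m]_x (euclid x ^+ 2)%:E = moment2 m); last first.
  by apply: eq_integral => x _; rewrite sqr_euclid.
have := moment2_ge0 m; case: (moment2 m) => [r| |]//.
  by rewrite ltry.
by move=> _; case: (\int[m]_x _).
Qed.

End potential.

(** * First variation of the energy *)

Section variation.
Local Open Scope ereal_scope.
Variable R : realType.
Local Notation plane := (R * R)%type.

(** Normalization does nothing to a measure of total mass 1 and produces a
    bundled probability; the Dirac mass is only its default value. *)
Lemma measure_to_probability d (T : measurableType d)
    (m : {measure set T -> \bar R}) : m setT = 1 ->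
  exists nu : probability T R, forall B, nu B = m B.
Proof.
move=> m1; exists (mnormalize m (dirac point)) => B.
by rewrite /= /mnormalize /= m1 onee_eq0 /= invr1 mule1.
Qed.

(** The competitor: a fraction t of the mass of A is moved onto sigma. *)
Lemma transfer_mass (mu sigma : probability plane R) (A : set plane)
    (mA : measurable A) (t : R) : (0 <= t <= 1)%R ->
  let m0 := mrestr mu (measurableC mA) in
  let m1 := mrestr mu mA in
  exists nu : probability plane R,
    (forall B, measurable B -> nu B =
       m0 B + ((1 - t)%:E * m1 B + (t * fine (mu A))%:E * sigma B)) /\
    (forall f : plane -> \bar R, measurable_fun setT f -> (forall x, 0 <= f x) ->
      \int[nu]_x f x = \int[m0]_x f x +
        ((1 - t)%:E * \int[m1]_x f x +
         (t * fine (mu A))%:E * \int[sigma]_x f x)).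
Proof.
move=> /andP[t0 t1] m0 m1.
have t1' : (0 <= 1 - t)%R by rewrite subr_ge0.
have s0 : (0 <= t * fine (mu A))%R by rewrite mulr_ge0// fine_ge0.
pose p1 := NngNum t1'; pose p2 := NngNum s0.
pose nu0 := measure_add m0 (measure_add (mscale p1 m1) (mscale p2 sigma)).
have nu0E B : nu0 B = m0 B + ((1 - t)%:E * m1 B + (t * fine (mu A))%:E * sigma B).
  by rewrite /nu0 measure_addE [X in _ + X]measure_addE.
have Afin : mu A \is a fin_num by exact: fin_num_measure.
have nu0T : nu0 setT = 1.
  rewrite nu0E /m0 /m1 /= /mrestr !setTI.
  have := @probability_setC _ _ _ mu _ mA; rewrite /= => ->.
  have -> : sigma setT = 1 by exact: probability_setT.
  case: (mu A) Afin => //= r _.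
  by rewrite mule1 -EFinM -!EFinD; congr EFin; lra.
have [nu nuE] := measure_to_probability nu0T.
exists nu; split; first by move=> B mB; exact: etrans (nuE B) (nu0E B).
move=> f mf f0.
rewrite (@eq_measure_integral _ _ _ setT nu0 nu)/=; last by move=> B _ _; exact: nuE.
rewrite /nu0 ge0_integral_measure_add//; congr (_ + _).
rewrite ge0_integral_measure_add//; congr (_ + _);
  by rewrite ge0_integral_mscale.
Qed.

Lemma pairing_mixture (m1 m2 m3 nu : {finite_measure set plane -> \bar R})
    (k s : R) : (0 <= k)%R -> (0 <= s)%R ->
  (forall f : plane -> \bar R, measurable_fun setT f -> (forall x, 0 <= f x) ->
    \int[nu]_x f x = \int[m1]_x f x + (k%:E * \int[m2]_x f x + s%:E * \int[m3]_x f x)) ->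
  pairing nu nu =
    (pairing m1 m1 + (k%:E * pairing m2 m1 + s%:E * pairing m3 m1)) +
    (k%:E * (pairing m2 m1 + (k%:E * pairing m2 m2 + s%:E * pairing m3 m2)) +
     s%:E * (pairing m3 m1 + (k%:E * pairing m3 m2 + s%:E * pairing m3 m3))).
Proof.
move=> k0 s0 nuE.
have pairE (m : {finite_measure set plane -> \bar R}) : pairing nu m = pairing m1 m + (k%:E * pairing m2 m + s%:E * pairing m3 m).
  exact: (nuE (potential m) (measurable_potential m) (potential_ge0 m)).
have E1 := pairE nu.
have E2 := etrans (pairingC m1 nu) (pairE m1).
have E3 := etrans (pairingC m2 nu) (pairE m2).
have E4 := etrans (pairingC m3 nu) (pairE m3).
have C12 := pairingC m1 m2; have C13 := pairingC m1 m3; have C23 := pairingC m2 m3.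
move: E1 E2 E3 E4 C12 C13 C23.
move: (pairing nu nu) (pairing m1 nu) (pairing m2 nu) (pairing m3 nu)
  (pairing m1 m1) (pairing m2 m1) (pairing m3 m1) (pairing m1 m2) (pairing m1 m3)
  (pairing m2 m3) (pairing m3 m2).
by move=> *; subst.
Qed.

Lemma ge0_fin (x : \bar R) : 0 <= x -> x < +oo -> exists2 r, x = r%:E & (0 <= r)%R.
Proof. by case: x => // r r0 _; exists r. Qed.

Lemma adde_lty (x y : \bar R) : 0 <= x -> 0 <= y -> x + y < +oo ->
  x < +oo /\ y < +oo.
Proof. by case: x => [r| |]//; case: y => [s| |]// *; rewrite !ltry. Qed.

(** First-order condition at t = 0 for the quadratic polynomial t^2 Y - 2 t X,
    nonnegative on ]0,1]. *)
Lemma perturbation_ineq (X Y : R) :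
  (forall t, 0 < t <= 1 -> 2 * X <= t * Y)%R -> (X <= 0)%R.
Proof.
move=> h; rewrite leNgt; apply/negP => X0.
have Y1 : (0 < `|Y| + 1)%R by rewrite ltr_pwDr.
pose t := (X / (X + (`|Y| + 1)))%R.
have D0 : (0 < X + (`|Y| + 1))%R by rewrite addr_gt0.
have t01 : (0 < t <= 1)%R.
  by rewrite divr_gt0//= ler_pdivrMr// mul1r lerDl ltW.
have := h _ t01; rewrite /t mulrAC ler_pdivlMr//; apply/negP; rewrite -ltNge.
rewrite -mulrA mulrCA ltr_pM2l//; have := ler_norm Y; lra.
Qed.

(** The energy of the competitor minus that of mu is
    2 t (mu(A) \int P dsigma - \int_A P dmu) + O(t^2), and it is nonnegative
    for all t in [0,1].  The competitor keeps enough mass on S either because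
    no mass leaves S, or because all the moved mass arrives in S. *)
Lemma first_variation (mu sigma : probability plane R) (S A : set plane) (a : R) :
  measurable S -> measurable A ->
  is_minimizer (@log_energy R) (constrained_measures S a) mu ->
  log_energy mu < +oo ->
  moment2 sigma < +oo -> pairing sigma sigma < +oo ->
  \int[sigma]_x potential mu x < +oo ->
  A `&` S = set0 \/ sigma S = 1 ->
  \int[mu]_(x in A) potential mu x <= mu A * \int[sigma]_x potential mu x.
Proof.
move=> mS mA [Cmu minmu] Imu s2 ss sP AS.
have m2 := log_energy_moment2 Imu.
have Iss := log_energyE m2.
have mq : measurable_fun setT (EFin \o @sqnorm R).
  by apply/measurable_EFinP; exact: measurable_sqnorm.
have q0 (x : plane) : 0 <= (sqnorm x)%:E by rewrite lee_fin sqnorm_ge0.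
pose m0 : {finite_measure set plane -> \bar R} := mrestr mu (measurableC mA).
pose m1 : {finite_measure set plane -> \bar R} := mrestr mu mA.
have muE f : measurable_fun setT f -> (forall x, 0 <= f x) ->
    \int[mu]_x f x = \int[m0]_x f x + (1%:E * \int[m1]_x f x + 0%:E * \int[sigma]_x f x).
  move=> mf f0; rewrite mul1e mul0e adde0 !integral_mrestr//.
  rewrite -ge0_integral_setU ?setvU//; last 2 first.
  - exact: measurableC.
  - by apply/disj_setPS; rewrite setICl.
have mumuoo : pairing mu mu < +oo by rewrite -Iss.
move: mumuoo; rewrite (pairing_mixture ler01 (lexx 0%R) muE).
rewrite !mul1e !mul0e !adde0.
have pmu (m : {finite_measure set plane -> \bar R}) :
    pairing m mu = pairing m m0 + pairing m m1.
  rewrite (pairingC m mu) (pairingC m m0) (pairingC m m1).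
  apply: etrans (muE (potential m) (measurable_potential m) (potential_ge0 m)) _.
  by rewrite mul1e mul0e adde0.
have Amu : \int[mu]_(x in A) potential mu x = pairing m1 m0 + pairing m1 m1.
  rewrite -pmu -integral_mrestr//.
    exact: measurable_potential.
  exact: potential_ge0.
have smu : \int[sigma]_x potential mu x = pairing sigma m0 + pairing sigma m1.
  exact: pmu.
move: sP; rewrite Amu smu.
have muA : mu A = (fine (mu A))%:E by rewrite fineK// fin_num_measure.
rewrite muA.
have mA0 : (0 <= fine (mu A))%R by rewrite fine_ge0.
have Ikey t : (0 < t <= 1)%R -> pairing mu mu <=
    (pairing m0 m0 + ((1 - t)%:E * pairing m1 m0 + (t * fine (mu A))%:E * pairing sigma m0)) +
    ((1 - t)%:E * (pairing m1 m0 + ((1 - t)%:E * pairing m1 m1 + (t * fine (mu A))%:E * pairing sigma m1)) +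
     (t * fine (mu A))%:E * (pairing sigma m0 + ((1 - t)%:E * pairing sigma m1 + (t * fine (mu A))%:E * pairing sigma sigma))).
  move=> /andP[t0 t1].
  have t01 : (0 <= t <= 1)%R by rewrite (ltW t0).
  have u0 : (0 <= 1 - t)%R by rewrite subr_ge0.
  have s0 : (0 <= t * fine (mu A))%R by rewrite mulr_ge0// ltW.
  have [nu [nuB nuf]] := @transfer_mass mu sigma A mA t t01.
  rewrite -(pairing_mixture u0 s0 nuf).
  have nu2 : moment2 nu < +oo.
    rewrite /moment2 nuf//.
    have mle B (mB : measurable B) : \int[mrestr mu mB]_x (sqnorm x)%:E <= moment2 mu.
      by rewrite integral_mrestr//; apply: ge0_subset_integral => // x _.
    have m0le := mle _ (measurableC mA); have m1le := mle _ mA.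
    have i0 (m : {measure set plane -> \bar R}) : 0 <= \int[m]_x (sqnorm x)%:E.
      by apply: integral_ge0 => x _; exact: q0.
    apply: lte_add_pinfty; first exact: le_lt_trans m0le m2.
    apply: lte_add_pinfty; apply: lte_mul_pinfty => //.
    exact: le_lt_trans m1le m2.
  rewrite -Iss -(log_energyE nu2); apply: minmu.
  rewrite /constrained_measures /= (le_trans Cmu)//.
  rewrite nuB//= /mrestr.
  have Smu : mu S = mu (S `&` ~` A) + mu (S `&` A).
    rewrite -measureU//; last 3 first.
    - by apply: measurableI => //; exact: measurableC.
    - exact: measurableI.
    - by rewrite setIACA setICl setI0.
    by rewrite -setIUr setvU setIT.
  rewrite Smu leeD2l//; case: AS => [AS|S1].
    by rewrite setIC AS measure0 mule0 add0e mule_ge0.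
  have SA : (S `&` A) `<=` A by exact: subIsetr.
  have SAle : mu (S `&` A) <= mu A.
    by apply: le_measure; rewrite ?inE//; exact: measurableI.
  rewrite S1 mule1 EFinM -muA.
  have SAfin : mu (S `&` A) \is a fin_num.
    by apply: fin_num_measure; exact: measurableI.
  apply: (@le_trans _ _ ((1 - t)%:E * mu (S `&` A) + t%:E * mu (S `&` A))).
    by rewrite -ge0_muleDl ?lee_fin// ?(ltW t0)// -EFinD subrK mul1e.
  by rewrite leeD2l// lee_pmul2l.
move: Ikey; rewrite (pairing_mixture ler01 (lexx 0%R) muE) !mul1e !mul0e !adde0.
move=> key sPoo mumuoo.
have [q1 q2] := adde_lty (adde_ge0 (pairing_ge0 m0 m0) (pairing_ge0 m1 m0))
  (adde_ge0 (pairing_ge0 m1 m0) (pairing_ge0 m1 m1)) mumuoo.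
have [q00 q10] := adde_lty (pairing_ge0 m0 m0) (pairing_ge0 m1 m0) q1.
have [_ q11] := adde_lty (pairing_ge0 m1 m0) (pairing_ge0 m1 m1) q2.
have [qs0 qs1] := adde_lty (pairing_ge0 sigma m0) (pairing_ge0 sigma m1) sPoo.
move: key; move: (fine (mu A)) mA0 => m mA0.
have [p00 -> _] := ge0_fin (pairing_ge0 m0 m0) q00.
have [p10 -> _] := ge0_fin (pairing_ge0 m1 m0) q10.
have [p11 -> _] := ge0_fin (pairing_ge0 m1 m1) q11.
have [ps0 -> _] := ge0_fin (pairing_ge0 sigma m0) qs0.
have [ps1 -> _] := ge0_fin (pairing_ge0 sigma m1) qs1.
have [pss -> _] := ge0_fin (pairing_ge0 sigma sigma) ss.
rewrite -?EFinD -?EFinM -?EFinD -?EFinM !lee_fin => H.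
have := @perturbation_ineq (p10 + p11 - m * (ps0 + ps1)) (p11 + m ^+ 2 * pss - 2 * m * ps1).
rewrite subr_le0; apply => t t01; have := H t t01.
rewrite -?EFinD -?EFinM -?EFinD -?EFinM -?EFinD -?EFinM -?EFinD !lee_fin.
have t0 : (0 < t)%R by case/andP: t01.
rewrite -subr_ge0 => h.
have {}h : (0 <= t * (t * (p11 + m ^+ 2 * pss - 2 * m * ps1) - 2 * (p10 + p11 - m * (ps0 + ps1))))%R.
  by apply: le_trans h _; rewrite le_eqVlt; apply/orP; left; apply/eqP; ring.
by move: h; rewrite pmulr_rge0// subr_ge0.
Qed.

End variation.

(** * Uniform measures on arcs *)

Section arcs.
Local Open Scope ereal_scope.
Variable R : realType.
Local Notation plane := (R * R)%type.
Local Notation leb := (@lebesgue_measure R).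

(** The lower Lipschitz bound prevents the arc from folding: it is what makes
    the potential of the arc bounded. *)
Definition expanding_arc (gamma : R -> plane) (a b c : R) : Prop :=
  [/\ measurable_fun setT gamma, (a < b)%R, (0 < c)%R &
   {in `[a, b] &, forall s t, c * `|s - t| <= euclid (gamma s - gamma t)}%R].

(** Potential of the uniform probability on the arc, that is of the image of
    the normalized Lebesgue measure of [a,b]. *)
Definition arc_potential (gamma : R -> plane) (a b : R) (y : plane) : \bar R :=
  ((b - a)^-1)%:E * \int[leb]_(t in `[a, b]) logkernel y (gamma t).

Lemma integral_dyadic_count_arc gamma a b c e y :
  expanding_arc gamma a b c -> (0 < e)%R ->
  \int[leb]_(t in `[a, b]) dyadic_count e (euclid (y - gamma t)%R)
  <= (8 * e / c)%:E.
Proof.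
move=> [mg ab c0 hg] e0; apply: integral_dyadic_count => //.
  exact: measurable_euclidB.
move=> s t sab tab; apply: (le_trans (hg _ _ sab tab)).
by rewrite (euclidC y (gamma s)) euclid_triangle.
Qed.

Lemma arc_potential_le gamma a b c M y :
  expanding_arc gamma a b c -> (0 <= M)%R ->
  (forall t, t \in `[a, b] -> sqnorm (gamma t) <= M)%R ->
  arc_potential gamma a b y <=
    ((sqnorm y + M) / 2 + 8 / (c * (b - a)))%:E.
Proof.
move=> ga M0 hM; have [mg ab c0 _] := ga.
have ba0 : (0 < b - a)%R by rewrite subr_gt0.
have md : measurable_fun setT (fun t => dyadic_count 1 (euclid (y - gamma t)%R)).
  by apply: measurable_dyadic_count; exact: measurable_euclidB.
have sy0 : (0 <= (sqnorm y + M) / 2)%R.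
  by rewrite divr_ge0// addr_ge0// sqnorm_ge0.
rewrite /arc_potential muleC lee_pdivrMr//.
apply: (@le_trans _ _ (\int[leb]_(t in `[a, b])
   (((sqnorm y + M) / 2)%:E + dyadic_count 1 (euclid (y - gamma t)%R)))).
  apply: ge0_le_integral => //.
  - by move=> t _; exact: logkernel_ge0.
  - by apply: measurable_funTS; exact: measurable_logkernel.
  - by apply: measurable_funTS; exact: emeasurable_funD.
  - move=> t tab; rewrite /logkernel addeC leeD// ?lee_fin; first by have := hM t tab; lra.
    by have := neglog_le_dyadic_count ltr01 (euclid_ge0 (y - gamma t)%R); rewrite ln1 oppr0 add0e.
rewrite ge0_integralD//; last 2 first.
- by move=> t _; exact: dyadic_count_ge0.
- exact: measurable_funTS.
rewrite integral_cst//= lebesgue_measure_itv/= lte_fin ab -EFinD -EFinM.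
apply: (le_trans (leeD2l _ (integral_dyadic_count_arc y ga ltr01))).
rewrite -EFinD lee_fin le_eqVlt; apply/orP; left; apply/eqP.
by field; rewrite ?lt0r_neq0.
Qed.

(** The bounded potential of an arc gives it finite mutual energy with every
    probability of finite second moment, including itself. *)
Lemma arc_measure_exists gamma a b c M :
  expanding_arc gamma a b c -> (0 <= M)%R ->
  (forall t, t \in `[a, b] -> sqnorm (gamma t) <= M)%R ->
  exists sigma : probability plane R,
  [/\ forall y, potential sigma y = arc_potential gamma a b y,
      forall S, measurable S -> (forall t, t \in `[a, b] -> S (gamma t)) ->
        sigma S = 1,
      moment2 sigma < +oo &
      forall mu : probability plane R, moment2 mu < +oo -> pairing sigma mu < +oo].
Proof.
move=> ga M0 hM; have [mg ab c0 _] := ga.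
pose X : {RV (uniform_prob ab) >-> plane} :=
  HB.pack gamma (isMeasurableFun.Build _ _ (measurableTypeR R) plane gamma mg).
pose sigma : probability plane R := distribution (uniform_prob ab) X.
have sE f : measurable_fun setT f -> (forall x, 0 <= f x) ->
    \int[sigma]_x f x = ((b - a)^-1)%:E * \int[leb]_(t in `[a, b]) f (gamma t).
  move=> mf f0; rewrite ge0_integral_distribution//.
  rewrite integral_uniform//; first exact: measurableT_comp.
  by move=> x; exact: f0.
have ba0 : (0 < b - a)%R by rewrite subr_gt0.
have s2 : moment2 sigma <= M%:E.
  rewrite /moment2 sE//.
  rewrite muleC lee_pdivrMr//.
  apply: (@le_trans _ _ (\int[leb]_(t in `[a, b]) M%:E)).
    apply: ge0_le_integral => //.
    + by move=> t _; rewrite lee_fin sqnorm_ge0.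
    + apply: measurable_funTS; apply/measurable_EFinP.
      exact: measurableT_comp (@measurable_sqnorm R) mg.
  by rewrite integral_cst//= lebesgue_measure_itv/= lte_fin ab -EFinD.
  - by apply/measurable_EFinP; exact: measurable_sqnorm.
  - by move=> x; rewrite lee_fin sqnorm_ge0.
have pE y : potential sigma y = arc_potential gamma a b y.
  by rewrite /potential sE//; [exact: measurable_logkernel|move=> x; exact: logkernel_ge0].
exists sigma; split => //.
- move=> S mS hS; rewrite /sigma /distribution /pushforward /= /uniform_prob.
  by apply: (integral_uniform_pdf1 ab) => t /hS.
- exact: le_lt_trans s2 (ltry _).
- move=> mu mu2; rewrite pairingC.
  set C := ((M / 2) + 8 / (c * (b - a)))%R.
  have C0 : (0 <= C)%R by rewrite addr_ge0 ?divr_ge0// mulr_ge0// ltW.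
  apply: (@le_lt_trans _ _ (\int[mu]_y ((2^-1)%:E * (sqnorm y)%:E + C%:E))).
    apply: ge0_le_integral => //.
    + by move=> y _; exact: potential_ge0.
    + exact: measurable_potential.
    + apply: emeasurable_funD => //; apply/measurable_EFinP; apply: measurable_funM => //.
      exact: measurable_sqnorm.
    + move=> y _; rewrite pE (le_trans (arc_potential_le y ga M0 hM))//.
      by rewrite -EFinM -EFinD lee_fin /C; lra.
  rewrite ge0_integralD//; last 2 first.
  + by move=> y _; rewrite -EFinM lee_fin mulr_ge0// sqnorm_ge0.
  + apply/measurable_EFinP; apply: measurable_funM => //.
    exact: measurable_sqnorm.
  rewrite integral_cst_probability ?lee_fin// lte_add_pinfty ?ltry//.
  rewrite ge0_integralZl ?lte_mul_pinfty//.
  + by apply/measurable_EFinP; exact: measurable_sqnorm.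
  + by move=> y _; rewrite lee_fin sqnorm_ge0.
Qed.

(** By the symmetry of the mutual energy, the mean of the potential of mu over
    the arc is the mu-mean of the potential of the arc. *)
Lemma arc_variation (mu : probability plane R) (S A : set plane) (m : R)
    gamma a b c M :
  measurable S -> measurable A ->
  is_minimizer (@log_energy R) (constrained_measures S m) mu ->
  log_energy mu < +oo ->
  expanding_arc gamma a b c -> (0 <= M)%R ->
  (forall t, t \in `[a, b] -> sqnorm (gamma t) <= M)%R ->
  A `&` S = set0 \/ (forall t, t \in `[a, b] -> S (gamma t)) ->
  \int[mu]_(x in A) potential mu x <= mu A * \int[mu]_y arc_potential gamma a b y.
Proof.
move=> mS mA mumin muoo ga M0 hM AS.
have [sigma [pE sS s2 sp]] := arc_measure_exists ga M0 hM.
have -> : \int[mu]_y arc_potential gamma a b y = \int[sigma]_x potential mu x.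
  rewrite -[RHS]/(pairing sigma mu) pairingC.
  by apply: eq_integral => y _; rewrite pE.
have smu : \int[sigma]_x potential mu x < +oo.
  by apply: (sp mu); exact: log_energy_moment2.
apply: (first_variation mS mA mumin muoo s2 (sp sigma s2) smu).
by case: AS => [|hS]; [left|right; exact: (sS S mS hS)].
Qed.

End arcs.

(** * Regular polygons with a power of two of vertices *)

Section roots_of_unity.
Variable R : realType.
Local Notation plane := (R * R)%type.
Implicit Types (z w : plane) (s r : R).

Definition scal (s : R) (w : plane) : plane := (s * w.1, s * w.2).

(** The square of z as a complex number. *)
Definition csq (z : plane) : plane := (z.1 ^+ 2 - z.2 ^+ 2, 2 * z.1 * z.2).

Lemma euclidM_eq z w u : sqnorm z * sqnorm w = sqnorm u ->
  euclid z * euclid w = euclid u.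
Proof.
by move=> h; rewrite /euclid -sqrtrM ?sqnorm_ge0//; congr Num.sqrt.
Qed.

Lemma euclid_csq z : euclid (csq z) = euclid z ^+ 2.
Proof. by rewrite expr2; apply/esym/euclidM_eq; rewrite /sqnorm /=; ring. Qed.

Lemma euclid_csqB z w :
  euclid (z - w) * euclid (z + w) = euclid (csq z - csq w).
Proof. by apply: euclidM_eq; rewrite /sqnorm /=; ring. Qed.

(** Half-angle formula; at w = -1 it degenerates and i is the root. *)
Definition csqrt w : plane :=
  if w.1 == -1 then (0, 1) else
  (Num.sqrt ((1 + w.1) / 2), w.2 / (2 * Num.sqrt ((1 + w.1) / 2))).

Lemma csqrtK w : sqnorm w = 1 -> csq (csqrt w) = w.
Proof.
case: w => u v; rewrite /sqnorm /csqrt /csq /= => uv1.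
have v2 : v ^+ 2 = 1 - u ^+ 2 by rewrite -uv1 addrC addKr.
case: eqVneq => [u1|u1] /=.
  have : v = 0 by apply/eqP; rewrite -sqrf_eq0 v2 u1 sqrrN expr1n subrr.
  by move=> ->; rewrite u1; congr pair; ring.
have h : 0 < (1 + u) / 2.
  have u2 : u ^+ 2 <= 1 by rewrite -subr_ge0 -v2 sqr_ge0.
  have u1' : -1 <= u by nra.
  have : -1 < u by rewrite lt_neqAle eq_sym u1.
  lra.
have s0 : 0 < Num.sqrt ((1 + u) / 2) by rewrite sqrtr_gt0.
have s2 : Num.sqrt ((1 + u) / 2) ^+ 2 = (1 + u) / 2 by rewrite sqr_sqrtr// ltW.
set q := Num.sqrt _ in s0 s2 *.
congr pair; last by field; rewrite lt0r_neq0.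
rewrite expr_div_n exprMn v2 s2.
by field; apply/eqP => e; move: h; rewrite e mul0r ltxx.
Qed.

Lemma sqnorm_csqrt w : sqnorm w = 1 -> sqnorm (csqrt w) = 1.
Proof.
move=> w1; have := euclid_csq (csqrt w); rewrite csqrtK// sqr_euclid => <-.
by rewrite /euclid -/(sqnorm w) w1 sqrtr1.
Qed.

(** The n-th roots of unity, seen through the only properties that are used.
    The third one says that the mean of |x + s w|^2 is |x|^2 + s^2, which
    includes that the barycenter is the origin; the last one is the modulus of
    \prod_w (z - s w) = z^n - s^n, bounded below by the triangle inequality. *)
Record polygon (n : nat) (W : seq plane) : Prop := Polygon {
  polygon_size : size W = n ;
  polygon_unit : {in W, forall w, sqnorm w = 1} ;
  polygon_center : forall x s,
    \sum_(w <- W) sqnorm (x + scal s w) = n%:R * (sqnorm x + s ^+ 2) ;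
  polygon_prod : forall z s, 0 <= s ->
    `|euclid z ^+ n - s ^+ n| <= \prod_(w <- W) euclid (z - scal s w) }.

Lemma polygon2 : polygon 2 [:: (1, 0); (-1, 0)].
Proof.
split => //.
- by move=> w; rewrite !inE => /orP[/eqP->|/eqP->]; rewrite /sqnorm /=; ring.
- by move=> x s; rewrite !big_cons big_nil /sqnorm /=; ring.
- move=> z s s0; rewrite !big_cons big_nil mulr1.
  have -> : z - scal s (-1, 0) = z + scal s (1, 0).
    by rewrite /scal /=; congr pair => /=; ring.
  rewrite euclid_csqB.
  have e2 : euclid (csq (scal s (1, 0))) = s ^+ 2.
    rewrite euclid_csq sqr_euclid /sqnorm /=; ring.
  rewrite -e2 -euclid_csq ler_norml; apply/andP; split.
    have := euclid_triangle (csq z) (csq (scal s (1, 0))) 0.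
    by rewrite !subr0 euclidC; lra.
  have := euclid_triangle (csq (scal s (1, 0))) (csq z) 0.
  by rewrite !subr0; lra.
Qed.

(** The two square roots of all the vertices: since
    (z - s v) (z + s v) = z^2 - s^2 v^2, the product over the new polygon at
    (z, s) is the product over the old one at (z^2, s^2). *)
Lemma polygon_double n W : polygon n W ->
  polygon n.*2 ([seq csqrt w | w <- W] ++ [seq - csqrt w | w <- W]).
Proof.
move=> [sW W1 Wc Wp]; split.
- by rewrite size_cat !size_map sW addnn.
- move=> w; rewrite mem_cat => /orP[] /mapP[v vW ->]; last first.
    by rewrite /sqnorm /= !sqrrN; exact: sqnorm_csqrt (W1 _ vW).
  exact: sqnorm_csqrt (W1 _ vW).
- move=> x s; rewrite big_cat !big_map; set p := (X in X = _).
  have -> : p = \sum_(w <- W) (sqnorm (x + scal s (csqrt w)) +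
      sqnorm (x + scal s (- csqrt w))) by rewrite big_split.
  rewrite (eq_big_seq (fun=> 2 * (sqnorm x + s ^+ 2))); last first.
    move=> w wW; have := sqnorm_csqrt (W1 _ wW); rewrite /sqnorm /= => h.
    apply: (@eq_trans _ _ (2 * (x.1 ^+ 2 + x.2 ^+ 2 +
      s ^+ 2 * ((csqrt w).1 ^+ 2 + (csqrt w).2 ^+ 2)))); first by ring.
    by rewrite h mulr1.
  rewrite big_const_seq count_predT sW iter_addr_0 -mulr_natl -muln2 natrM; ring.
- move=> z s s0; rewrite big_cat !big_map; set p := (X in _ <= X).
  have -> : p = \prod_(w <- W) (euclid (z - scal s (csqrt w)) *
      euclid (z - scal s (- csqrt w))) by rewrite big_split.
  rewrite (eq_big_seq (fun w => euclid (csq z - scal (s ^+ 2) w))); last first.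
    move=> w wW; have -> : z - scal s (- csqrt w) = z + scal s (csqrt w).
      by congr pair; rewrite /=; ring.
    rewrite euclid_csqB; congr (euclid (_ - _)).
    by rewrite -[in RHS](csqrtK (W1 _ wW)) /csq /scal /=; congr pair; ring.
  by have := Wp (csq z) (s ^+ 2) (sqr_ge0 _); rewrite euclid_csq -!exprM -muln2 mulnC.
Qed.

Lemma polygon_exists k : exists W, polygon (2 ^ k.+1) W.
Proof.
elim: k => [|k [W hW]]; first by exists [:: (1, 0); (-1, 0)]; exact: polygon2.
by eexists; rewrite expnS mul2n; exact: polygon_double hW.
Qed.

End roots_of_unity.

(** * Mean value inequality for the logarithm, at fixed radius *)

Section submean.
Variable R : realType.
Local Notation plane := (R * R)%type.
Implicit Types (z w x y : plane) (s r : R).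

(** The factor u^n takes n of the n+1 factors out of u^(n+1) - v^(n+1); only
    one of them remains singular at u = v. *)
Lemma ler_subX (u v : R) n : 0 <= v -> v <= u ->
  u ^+ n * (u - v) <= u ^+ n.+1 - v ^+ n.+1.
Proof.
move=> v0 vu; rewrite mulrBr -exprSr lerD2l lerN2 exprSr ler_wpM2r//.
by rewrite lerXn2r// nnegrE// (le_trans v0).
Qed.

Lemma ler_maxX_dist (u v : R) n : 0 <= u -> 0 <= v ->
  Num.max u v ^+ n * `|u - v| <= `|u ^+ n.+1 - v ^+ n.+1|.
Proof.
wlog vu : u v / v <= u => [hw u0 v0|u0 v0].
  case/orP: (le_total v u) => [vu|/hw h]; first exact: hw.
  by rewrite maxC distrC [leRHS]distrC; exact: h.
rewrite max_l// !ger0_norm ?subr_ge0//; first exact: ler_subX.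
by rewrite lerXn2r// nnegrE.
Qed.

Lemma sum_neglog (W : seq plane) (f : plane -> R) :
  (forall w, w \in W -> 0 < f w) ->
  (\sum_(w <- W) neglog (f w))%E = (- ln (\prod_(w <- W) f w))%:E.
Proof.
elim: W => [|w W IH] h; first by rewrite !big_nil ln1 oppr0.
have hW v : v \in W -> 0 < f v by move=> vW; apply: h; rewrite inE vW orbT.
have p0 : 0 < \prod_(v <- W) f v by rewrite big_seq prodr_gt0.
have fw := h w (mem_head _ _).
by rewrite !big_cons IH// neglogE// lnM ?posrE// opprD EFinD.
Qed.

(** Divided by the number n+1 of vertices this reads: the mean of
    log 1/|z - s w| over the polygon is at most log 1/|z|, less ln 2 if z is in
    the disk of radius r/2, up to an error O(1/n) that is integrable in s.
    Indeed |z^(n+1) - s^(n+1)| >= max(|z|,s)^n ||z| - s|. *)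
Lemma sum_neglog_polygon n W z s r : polygon n.+1 W -> 0 < r -> r <= s <= 2 * r ->
  (\sum_(w <- W) neglog (euclid (z - scal s w))%R +
     (n.+1%:R * ln 2 * (euclid z < r / 2)%R%:R)%:E <=
   n.+1%:R%:E * neglog (euclid z) + (ln 4)%:E + dyadic_count r `|euclid z - s|%R)%E.
Proof.
move=> [Wn _ _ Wp] r0 /andP[rs s2r].
have s0 : 0 < s by lra.
have l2 : 0 < ln 2 :> R by rewrite ln_gt0// ltr1n.
have l4 : 0 < ln 4 :> R by rewrite ln_gt0// ltr1n.
have D0 := dyadic_count_ge0 r `|euclid z - s|.
have := euclid_ge0 z; rewrite le_eqVlt => /predU1P[z0|rho0].
  rewrite -z0 neglog0 in D0 *; rewrite mulry gtr0_sg// mul1e -addeA addye ?leey//.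
  by case: dyadic_count D0.
have [rs0|rs0] := eqVneq (euclid z) s.
  by rewrite rs0 subrr normr0 dyadic_count0// neglogE// -EFinM -EFinD addey ?leey.
have d0 : 0 < `|euclid z - s| by rewrite normr_gt0 subr_eq0.
set M := Num.max (euclid z) s.
have M0 : 0 < M by rewrite lt_max rho0.
have hM : M ^+ n * `|euclid z - s| <= \prod_(w <- W) euclid (z - scal s w).
  by apply: le_trans (Wp z s (ltW s0)); apply: ler_maxX_dist; exact: ltW.
have MD0 : 0 < M ^+ n * `|euclid z - s| by rewrite mulr_gt0// exprn_gt0.
have P0 : 0 < \prod_(w <- W) euclid (z - scal s w) by apply: lt_le_trans hM.
have pos w : w \in W -> 0 < euclid (z - scal s w).
  move=> wW; rewrite lt_neqAle euclid_ge0 andbT eq_sym; apply/negP => /eqP e.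
  move: P0; suff -> : \prod_(w <- W) euclid (z - scal s w) = 0 by rewrite ltxx.
  apply/eqP; rewrite prodf_seq_eq0; apply/hasP; exists w => //=.
  by rewrite e eqxx.
rewrite (sum_neglog pos).
have lnP : n%:R * ln M + ln `|euclid z - s| <= ln (\prod_(w <- W) euclid (z - scal s w)).
  rewrite mulr_natl -lnXn// -lnM ?posrE ?exprn_gt0//.
  by rewrite ler_ln ?posrE.
have lnM2 : ln (euclid z) + ln 2 * (euclid z < r / 2)%R%:R <= ln M.
  case: (ltP (euclid z) (r / 2)) => [h|_] /=; last by rewrite mulr0 addr0 ler_ln ?posrE// le_max lexx.
  rewrite mulr1 -lnM ?posrE// ler_ln ?posrE ?mulr_gt0//.
  by rewrite le_max; apply/orP; right; lra.
(* For M <= 4 r the ratio M / ||z| - s| is at most 4 r / ||z| - s|; otherwise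
   M = |z| > 4 r >= 2 s and the ratio is at most 2. *)
have main : ((ln M - ln `|euclid z - s|)%:E <=
    (ln 4)%:E + dyadic_count r `|euclid z - s|%R)%E.
  have [Mr|Mr] := leP M (4 * r).
    have := neglog_le_dyadic_count r0 (ltW d0); rewrite neglogE//.
    have : ln M <= ln 4 + ln r by rewrite -lnM ?posrE// ler_ln ?posrE ?mulr_gt0.
    case: (dyadic_count _ _) D0 => [D| |]//; last by rewrite addey ?leey.
    by rewrite -!EFinD !lee_fin; lra.
  apply: (@le_trans _ _ (ln 4)%:E); last by rewrite leeDl.
  rewrite lee_fin lerBlDr -lnM ?posrE// ler_ln ?posrE ?mulr_gt0//.
  have zM : euclid z = M.
    by rewrite /M; case: leP => // h; move: Mr; rewrite /M max_r//; lra.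
  by rewrite zM ger0_norm; lra.
rewrite neglogE//.
case: (dyadic_count _ _) D0 main => [D| |]// D0; last by rewrite addey ?leey.
rewrite -?EFinM -?EFinD -?EFinM -?EFinD !lee_fin.
have : n.+1%:R * (ln (euclid z) + ln 2 * (euclid z < r / 2)%R%:R) <= n.+1%:R * ln M.
  by rewrite ler_pM2l.
rewrite -[in X in _ <= X -> _]natr1; lra.
Qed.

End submean.

(** * Mean value inequality for the kernel, averaged over the radius *)

Section submean_integrated.
Variable R : realType.
Local Notation plane := (R * R)%type.
Local Notation leb := (@lebesgue_measure R).
Implicit Types (z w x y : plane) (s r : R).

(** The points at distance s from x in the direction of a vertex w. *)
Definition segment x w : R -> plane := fun s => x + scal s w.

Lemma sum_logkernel_polygon n W x y s r : polygon n.+1 W -> 0 < r -> r <= s <= 2 * r ->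
  (\sum_(w <- W) logkernel y (segment x w s) +
     (n.+1%:R * ln 2 * (euclid (y - x) < r / 2)%R%:R)%:E <=
   n.+1%:R%:E * logkernel x y + (2 * n.+1%:R * r ^+ 2 + ln 4)%:E +
   dyadic_count r `|euclid (y - x) - s|%R)%E.
Proof.
move=> pW r0 rs; have := sum_neglog_polygon (y - x) pW r0 rs.
have -> : (\sum_(w <- W) neglog (euclid (y - x - scal s w)%R) =
           \sum_(w <- W) neglog (euclid (y - segment x w s)%R))%E.
  by apply: eq_bigr => w _; rewrite /segment opprD addrA.
have n0 : (0 <= n.+1%:R :> R) by [].
have -> : (\sum_(w <- W) logkernel y (segment x w s) =
    \sum_(w <- W) neglog (euclid (y - segment x w s)%R) +
    (n.+1%:R * ((sqnorm y + (sqnorm x + s ^+ 2)) / 2))%:E)%E.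
  rewrite /logkernel big_split/=; congr (_ + _)%E.
  rewrite sumEFin; congr EFin.
  rewrite -mulr_suml big_split/= (polygon_center pW) big_const_seq count_predT.
  rewrite (polygon_size pW) iter_addr_0 -mulr_natl; ring.
have -> : (n.+1%:R%:E * logkernel x y = n.+1%:R%:E * neglog (euclid (y - x)%R) +
    (n.+1%:R * ((sqnorm x + sqnorm y) / 2))%:E)%E.
  by rewrite /logkernel euclidC muleDr// fin_num_adde_defl.
move: (\sum_(w <- W) _)%E (n.+1%:R%:E * neglog _)%E (dyadic_count _ _) (dyadic_count_ge0 r `|euclid (y - x) - s|).
move=> A B D D0 h.
have h' := leeD2l (n.+1%:R * ((sqnorm y + (sqnorm x + s ^+ 2)) / 2))%:E h.
rewrite -addeA (addeC (_%:E) (_%:E)) addeA (addeC (A + _)%E) (le_trans h')//.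
have sr : s ^+ 2 <= 4 * r ^+ 2.
  by rewrite (_ : 4 * r ^+ 2 = (2 * r) ^+ 2); [rewrite lerXn2r ?nnegrE//; lra|ring].
have e : n.+1%:R * ((sqnorm y + (sqnorm x + s ^+ 2)) / 2) <=
    n.+1%:R * ((sqnorm x + sqnorm y) / 2) + 2 * n.+1%:R * r ^+ 2.
  rewrite -(mulrA 2) (mulrCA 2) -mulrDr ler_wpM2l//; lra.
rewrite !addeA leeD2r//.
case: B {h h'} => [B| |]//.
by rewrite -!EFinD lee_fin; lra.
Qed.

Lemma measurable_arc_potential gamma a b c M :
  expanding_arc gamma a b c -> 0 <= M ->
  (forall t, t \in `[a, b] -> sqnorm (gamma t) <= M) ->
  measurable_fun setT (@arc_potential R gamma a b).
Proof.
move=> ga M0 hM; have [sigma [pE _ _ _]] := arc_measure_exists ga M0 hM.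
rewrite (_ : arc_potential _ _ _ = potential sigma); last first.
  by apply/funext => y; rewrite pE.
exact: measurable_potential.
Qed.

Lemma arc_potential_ge0 gamma a b y : a <= b ->
  (0 <= @arc_potential R gamma a b y)%E.
Proof.
move=> ab; apply: mule_ge0; first by rewrite lee_fin invr_ge0 subr_ge0.
by apply: integral_ge0 => t _; exact: logkernel_ge0.
Qed.

Lemma measurable_segment x w : measurable_fun setT (segment x w).
Proof.
apply/measurable_fun_pairP; split; rewrite /comp /=;
  by apply: measurable_funD => //; apply: measurable_funM.
Qed.

Lemma segment_expanding x w r : sqnorm w = 1 -> 0 < r ->
  expanding_arc (segment x w) r (2 * r) 1.
Proof.
move=> w1 r0; split => //; first exact: measurable_segment.
- lra.
- move=> s t _ _; rewrite mul1r.
  have -> : segment x w s - segment x w t = scal (s - t) w.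
    by rewrite /segment /scal; congr pair => /=; ring.
  rewrite /euclid /= !exprMn -mulrDr -/(sqnorm w) w1 mulr1.
  by rewrite sqrtr_sqr.
Qed.

Lemma segment_bounded x w r s : sqnorm w = 1 -> 0 < r -> s \in `[r, 2 * r] ->
  sqnorm (segment x w s) <= 2 * (sqnorm x + (2 * r) ^+ 2).
Proof.
move=> w1 r0; rewrite in_itv/= => /andP[rs s2r].
have -> : segment x w s = x - (- scal s w) by rewrite opprK.
apply: (le_trans (sqnormB_le _ _)); rewrite ler_pM2l// lerD2l.
have -> : sqnorm (- scal s w) = s ^+ 2 * sqnorm w by rewrite /sqnorm /=; ring.
by rewrite w1 mulr1 lerXn2r ?nnegrE//; lra.
Qed.

(** The error of the fixed radius inequality is a dyadic count of the distance
    of s to |y - x|; its integral over [r, 2r] is at most 8 r. *)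
Lemma sum_arc_potential_polygon n W x y r : polygon n.+1 W -> 0 < r ->
  (\sum_(w <- W) arc_potential (segment x w) r (2 * r) y +
     (n.+1%:R * ln 2 * (euclid (y - x) < r / 2)%R%:R)%:E <=
   n.+1%:R%:E * logkernel x y + (2 * n.+1%:R * r ^+ 2 + ln 4 + 8)%:E)%E.
Proof.
move=> pW r0.
have r2 : r < 2 * r by lra.
have rr : 2 * r - r = r by ring.
have l2 : 0 < ln 2 :> R by rewrite ln_gt0// ltr1n.
have l4 : 0 < ln 4 :> R by rewrite ln_gt0// ltr1n.
have mk w : measurable_fun setT (fun s => logkernel y (segment x w s)).
  by apply: measurable_logkernel => //; exact: measurable_segment.
set c1 := (n.+1%:R * ln 2 * _)%R.
have c10 : 0 <= c1 by rewrite !mulr_ge0// ltW.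
set c2 := (2 * n.+1%:R * r ^+ 2 + ln 4)%R.
have c20 : 0 <= c2 by rewrite addr_ge0 ?(ltW l4)// mulr_ge0// sqr_ge0.
have K0 : (0 <= n.+1%:R%:E * logkernel x y)%E by rewrite mule_ge0// ?lee_fin// logkernel_ge0.
have sumE : (\sum_(w <- W) arc_potential (segment x w) r (2 * r) y =
    (r^-1)%:E * \int[leb]_(s in `[r, (2 * r)%R]) \sum_(w <- W) logkernel y (segment x w s))%E.
  rewrite ge0_integral_sum//; last 2 first.
  - by move=> w; apply: measurable_funTS; exact: mk.
  - by move=> w s _; exact: logkernel_ge0.
  rewrite ge0_sume_distrr; last by move=> w _; apply: integral_ge0 => s _; exact: logkernel_ge0.
  by apply: eq_bigr => w _; rewrite /arc_potential rr.
have md : measurable_fun setT (fun s => dyadic_count r `|euclid (y - x)%R - s|%R).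
  apply: measurable_dyadic_count; apply: measurableT_comp => //.
  exact: measurable_funB.
have ms : measurable_fun setT (fun s => \sum_(w <- W) logkernel y (segment x w s))%E.
  exact: emeasurable_sum.
have lenr : leb `[r, 2 * r] = r%:E.
  by rewrite lebesgue_measure_itv/= lte_fin r2 -EFinD rr.
have integrated : (\int[leb]_(s in `[r, (2 * r)%R]) (\sum_(w <- W) logkernel y (segment x w s) + c1%:E) <=
  \int[leb]_(s in `[r, (2 * r)%R]) (n.+1%:R%:E * logkernel x y + c2%:E + dyadic_count r `|euclid (y - x)%R - s|%R))%E.
  apply: ge0_le_integral => //.
  - by move=> s _; rewrite adde_ge0// sume_ge0// => w _; exact: logkernel_ge0.
  - by apply: measurable_funTS; exact: emeasurable_funD.
  - by apply: measurable_funTS; exact: emeasurable_funD.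
  - by move=> s; rewrite /= in_itv/= => rs; exact: sum_logkernel_polygon.
move: integrated; rewrite ge0_integralD//; last 2 first.
- by move=> s _; rewrite sume_ge0// => w _; exact: logkernel_ge0.
- exact: measurable_funTS.
rewrite [X in (_ <= X)%E]ge0_integralD//; last 3 first.
- by move=> s _; rewrite adde_ge0.
- by move=> s _; exact: dyadic_count_ge0.
- exact: measurable_funTS.
rewrite !integral_cst//= lenr => integrated.
have dle : (\int[leb]_(s in `[r, (2 * r)%R]) dyadic_count r `|euclid (y - x)%R - s|%R <= (8 * r)%:E)%E.
  have := @integral_dyadic_count R (fun s => `|euclid (y - x)%R - s|) 1 r (2 * r) r ltr01 r0.
  rewrite divr1; apply; first by apply: measurableT_comp => //; exact: measurable_funB.
  move=> s t _ _; rewrite mul1r.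
  rewrite (_ : s - t = (euclid (y - x) - t) - (euclid (y - x) - s)); last by ring.
  by rewrite [leRHS]addrC; exact: ler_normB.
have {}integrated := le_trans integrated (leeD2l _ dle).
have ri : (0 <= r^-1%:E)%E by rewrite lee_fin invr_ge0 ltW.
have := lee_wpmul2l ri integrated.
rewrite sumE ge0_muleDr ?mule_ge0 ?lee_fin ?(ltW r0)//; last first.
  by apply: integral_ge0 => s _; rewrite sume_ge0// => w _; exact: logkernel_ge0.
have r00 : r != 0 by rewrite gt_eqF.
have canc X : (r^-1%:E * (X * r%:E) = X)%E.
  by rewrite (muleC X) muleA -EFinM mulVf// mul1e.
rewrite canc => /le_trans; apply.
rewrite EFinM ge0_muleDr ?mule_ge0 ?lee_fin ?(ltW r0)// ?adde_ge0// !canc.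
by rewrite -addeA.
Qed.

End submean_integrated.

(** * Quadratic decay of the mass of disks *)

Section density.
Variable R : realType.
Local Notation plane := (R * R)%type.
Implicit Types (w x y : plane) (r : R) (mu : probability (R * R)%type R).

Definition disk x r : set plane := [set y | euclid (y - x) < r].

Lemma measurable_disk x r : measurable (disk x r).
Proof.
rewrite (_ : disk x r = (fun y => euclid (y - x)) @^-1` `]-oo, r[%classic).
  rewrite -[X in measurable X]setTI.
  have mf : measurable_fun setT (fun y => euclid (y - x)) by exact: measurable_euclidB.
  exact: mf.
by apply/seteqP; split=> t /=; rewrite in_itv.
Qed.

Lemma integral_disk mu x r (k : R) : 0 <= k ->
  (\int[mu]_y (k * (euclid (y - x) < r)%R%:R)%:E = k%:E * mu (disk x r))%E.
Proof.
move=> k0.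
have e : (fun y => (k * (euclid (y - x) < r)%R%:R)%:E)
  = (fun y => k%:E * (\1_(disk x r) y)%:E)%E :> (plane -> \bar R).
  apply/funext => y; rewrite EFinM indicE; congr (_ * (nat_of_bool _)%:R%:E)%E.
  by apply/idP/idP; rewrite inE.
have mi : measurable_fun setT (fun y : plane => (\1_(disk x r) y)%:E : \bar R).
  by apply/measurable_EFinP; apply: measurable_indic; exact: measurable_disk.
rewrite e (@ge0_integralZl _ _ _ mu setT measurableT _ mi k%:E) ?lee_fin//.
by rewrite integral_indic ?setIT//; exact: measurable_disk.
Qed.

(** Mean value inequality for the potential of mu over the segments that fill
    the annulus between r and 2r, with the gain due to the mass that mu has
    inside. *)
Lemma submean mu n W x r : polygon n.+1 W -> 0 < r ->
  (\sum_(w <- W) \int[mu]_y arc_potential (segment x w) r (2 * r) y +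
     (n.+1%:R * ln 2)%:E * mu (disk x (r / 2)) <=
   n.+1%:R%:E * potential mu x + (2 * n.+1%:R * r ^+ 2 + ln 4 + 8)%:E)%E.
Proof.
move=> pW r0.
have l2 : 0 < ln 2 :> R by rewrite ln_gt0// ltr1n.
have l4 : 0 < ln 4 :> R by rewrite ln_gt0// ltr1n.
have k0 : 0 <= n.+1%:R * ln 2 :> R by rewrite mulr_ge0// ltW.
have c0 : 0 <= 2 * n.+1%:R * r ^+ 2 + ln 4 + 8 :> R.
  by rewrite !addr_ge0 ?(ltW l4)// mulr_ge0// sqr_ge0.
have r2 : r <= 2 * r by lra.
have M0 : 0 <= 2 * (sqnorm x + (2 * r) ^+ 2).
  by rewrite mulr_ge0// addr_ge0 ?sqnorm_ge0 ?sqr_ge0.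
have ma w : w \in W -> measurable_fun setT (arc_potential (segment x w) r (2 * r)).
  move=> wW; have w1 := polygon_unit pW wW.
  apply: (measurable_arc_potential (segment_expanding x w1 r0) M0) => t.
  exact: segment_bounded.
have md : measurable_fun setT
    (fun y : plane => (n.+1%:R * ln 2 * (euclid (y - x) < r / 2)%R%:R)%:E : \bar R).
  apply/measurable_EFinP; apply: measurable_funM => //.
  by apply: measurable_ltr_indic; exact: measurable_euclidB.
have sumE : (\sum_(w <- W) \int[mu]_y arc_potential (segment x w) r (2 * r) y =
  \int[mu]_y \sum_(w <- W) arc_potential (segment x w) r (2 * r) y)%E.
  pose f w := if w \in W then arc_potential (segment x w) r (2 * r) else cst 0%E.
  rewrite (eq_big_seq (fun w => \int[mu]_y f w y)%E); last first.
    by move=> w wW; rewrite /f wW.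
  rewrite -ge0_integral_sum//.
  - apply: eq_integral => y _; apply: eq_big_seq => w wW; by rewrite /f wW.
  - by move=> w; rewrite /f; case: ifPn => // /ma.
  - by move=> w y _; rewrite /f; case: ifPn => // _; exact: arc_potential_ge0.
have ms : measurable_fun setT
   (fun y => \sum_(w <- W) arc_potential (segment x w) r (2 * r) y)%E.
  rewrite (_ : (fun y => _) = fun y => \sum_(w <- W) (if w \in W then arc_potential (segment x w) r (2 * r) y else 0)%E)%E.
    apply: emeasurable_sum => w.
    by case: (boolP (w \in W)) => // /ma.
  by apply/funext => y; apply: eq_big_seq => w ->.
have s0 y : (0 <= \sum_(w <- W) arc_potential (segment x w) r (2 * r) y)%E.
  by rewrite sume_ge0// => w _; exact: arc_potential_ge0.
rewrite sumE -integral_disk// -ge0_integralD//; last first.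
  by move=> y _; rewrite lee_fin mulr_ge0.
apply: (@le_trans _ _ (\int[mu]_y (n.+1%:R%:E * logkernel x y + (2 * n.+1%:R * r ^+ 2 + ln 4 + 8)%:E))%E).
  apply: ge0_le_integral => //.
  - by move=> y _; rewrite adde_ge0// lee_fin mulr_ge0.
  - exact: emeasurable_funD.
  - apply: emeasurable_funD => //; apply: measurable_funeM; exact: measurable_logkernel.
  - by move=> y _; exact: sum_arc_potential_polygon.
rewrite ge0_integralD//; last 2 first.
- by move=> y _; rewrite mule_ge0 ?lee_fin// logkernel_ge0.
- by apply: measurable_funeM; exact: measurable_logkernel.
rewrite ge0_integralZl ?lee_fin//; last 2 first.
- exact: measurable_logkernel.
- by move=> y _; exact: logkernel_ge0.
by rewrite integral_cst_probability ?lee_fin.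
Qed.

Lemma ln2_ge : 2^-1 <= ln 2 :> R.
Proof.
have := @ln_le_subr1 R 2^-1; rewrite invr_gt0 ltr0n lnV ?posrE// => /(_ isT); lra.
Qed.

(** A point whose potential is at most its means around it is one where the
    gain ln 2 mu(B(x,r/2)) in the mean value inequality is at most the O(r^2)
    caused by the confinement; the number of vertices tends to infinity. *)
Lemma small_density mu x : (potential mu x < +oo)%E ->
  (forall w r, sqnorm w = 1 -> 0 < r ->
    (potential mu x <= \int[mu]_y arc_potential (segment x w) r (2 * r) y)%E) ->
  forall r, 0 < r -> (mu (disk x r) <= (16 * r ^+ 2)%:E)%E.
Proof.
move=> Poo hP r r0.
have r20 : 0 < 2 * r by lra.
have mfin : mu (disk x r) = (fine (mu (disk x r)))%:E.
  by rewrite fineK// fin_num_measure//; exact: measurable_disk.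
rewrite mfin lee_fin; set m := fine _ in mfin *.
have Pfin : potential mu x = (fine (potential mu x))%:E.
  by rewrite fineK// ge0_fin_numE// potential_ge0.
(* 12 bounds ln 4 + 8 ; the radius of the inequality is 2 r. *)
have key k : 2^-1 * m <= 8 * r ^+ 2 + 12 / 2 ^+ k.+1.
  have [W pW] := @polygon_exists R k.
  have N0 : (0 < 2 ^ k.+1)%N by rewrite expn_gt0.
  move: pW; rewrite -(prednK N0) => pW.
  have := submean mu x pW r20; rewrite (_ : 2 * r / 2 = r); last by field.
  rewrite mfin.
  have lb : ((2 ^ k.+1).-1.+1%:R%:E * potential mu x <=
    \sum_(w <- W) \int[mu]_y arc_potential (segment x w) (2 * r) (2 * (2 * r)) y)%E.
    rewrite -[in leLHS](polygon_size pW).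
    have -> : ((size W)%:R%:E * potential mu x = \sum_(w <- W) potential mu x)%E.
      by rewrite big_const_seq count_predT Pfin -EFinM; elim: (size W) => [|s IH] /=;
        rewrite ?mul0r// -IH -EFinD -natr1; congr EFin; ring.
    rewrite big_seq [leRHS]big_seq; apply: lee_sum => w wW.
    by apply: hP => //; exact: (polygon_unit pW).
  move=> /(le_trans (leeD2r _ lb)).
  rewrite Pfin -!EFinM -!EFinD lee_fin prednK// natrX => h.
  have {}h : 2 ^+ k.+1 * (ln 2 * m) <= 2 ^+ k.+1 * (8 * r ^+ 2 + 12 / 2 ^+ k.+1).
    have -> : 2 ^+ k.+1 * (8 * r ^+ 2 + 12 / 2 ^+ k.+1) = 2 ^+ k.+1 * (8 * r ^+ 2) + 12 :> R.
      by rewrite mulrDr [X in _ + X]mulrCA divff ?mulr1// expf_neq0.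
    have l4 : ln 4 <= 4 - 1 :> R by exact: ln_le_subr1.
    have -> : 8 * r ^+ 2 = 2 * (2 * r) ^+ 2 by ring.
    lra.
  rewrite ler_pM2l ?exprn_gt0// in h.
  apply: le_trans h; rewrite ler_wpM2r ?ln2_ge//.
  by rewrite /m fine_ge0.
rewrite leNgt; apply/negP => hm.
have d0 : 0 < 2^-1 * m - 8 * r ^+ 2 by lra.
have [k hk] : exists k : nat, 12 / (2^-1 * m - 8 * r ^+ 2) < k%:R.
  by exists (Num.truncn (12 / (2^-1 * m - 8 * r ^+ 2))).+1; exact: truncnS_gt.
have hk2 : k%:R < 2 ^+ k.+1 :> R.
  by rewrite -natrX ltr_nat (ltn_trans (ltn_expl k (ltnSn 1)))// ltn_exp2l.
have := key k; rewrite -lerBlDl.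
have := lt_trans hk hk2; rewrite ltr_pdivrMr// => h1 h2.
have : 12 / 2 ^+ k.+1 < 2^-1 * m - 8 * r ^+ 2.
  by rewrite ltr_pdivrMr ?exprn_gt0// mulrC.
lra.
Qed.

End density.

(** * Potentials of arcs that shrink to a point *)

Section shrinking_arcs.
Variable R : realType.
Local Notation plane := (R * R)%type.
Local Notation leb := (@lebesgue_measure R).
Implicit Types (x y z : plane) (mu : probability (R * R)%type R).

(** Here rho is the distance of a point to the base of the arc and u its
    distance to a point of the arc, which is within 2 e of the base. *)
Lemma neglog_shift_far (e d rho u : R) : 0 < e -> 0 < d -> d <= rho -> 4 * e <= d ->
  rho - 2 * e <= u -> (neglog u <= neglog rho + (4 * e / d)%:E)%E.
Proof.
move=> e0 d0 dr ed ru.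
have r0 : 0 < rho by lra.
have u0 : 0 < rho - 2 * e by lra.
apply: (le_trans (le_neglog (ltW u0) ru)); rewrite !neglogE// -EFinD lee_fin.
have h : ln (rho / (rho - 2 * e)) <= rho / (rho - 2 * e) - 1.
  by apply: ln_le_subr1; rewrite divr_gt0.
rewrite lnM ?posrE ?invr_gt0// lnV ?posrE// in h.
suff : rho / (rho - 2 * e) - 1 <= 4 * e / d by lra.
have -> : rho / (rho - 2 * e) - 1 = 2 * e / (rho - 2 * e) by field; rewrite lt0r_neq0.
rewrite ler_pdivrMr// mulrAC ler_pdivlMr//; nra.
Qed.

Lemma neglog_shift_near (e rho u : R) : 0 < e -> 0 <= rho -> 0 <= u ->
  rho - 2 * e <= u -> (neglog u <= neglog rho + ((ln 4)%:E + dyadic_count e u))%E.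
Proof.
move=> e0; rewrite le_eqVlt => /predU1P[<- u0 _|r0 u0 ru].
  by rewrite neglog0 addye ?leey//; case: (dyadic_count e u) (dyadic_count_ge0 e u).
have D0 := dyadic_count_ge0 e u.
have l4 : ln 2 <= ln 4 :> R by rewrite ler_ln// ?posrE; lra.
have [re|re] := ltP rho (4 * e).
  apply: (le_trans (neglog_le_dyadic_count e0 u0)).
  rewrite addeA leeD2r// neglogE// -EFinD lee_fin.
  have : ln rho <= ln (4 * e) by rewrite ler_ln ?posrE ?mulr_gt0// ltW.
  by rewrite lnM ?posrE//; lra.
have r20 : 0 < rho / 2 by lra.
have ru' : rho / 2 <= u by lra.
apply: (le_trans (le_neglog (ltW r20) ru')).
rewrite addeA; apply: (@le_trans _ _ (neglog rho + (ln 4)%:E)%E); last by rewrite leeDl.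
rewrite !neglogE// -EFinD lee_fin lnM ?posrE// lnV ?posrE//; lra.
Qed.

(** Far from the base point the potential of a short arc is close to the kernel
    at the base point, and near the base point it exceeds the kernel by no more
    than a constant that does not depend on the length of the arc. *)
Lemma arc_potential_shrink gamma t0 e c d q y :
  expanding_arc gamma t0 (t0 + e) c -> 0 < d -> 4 * e <= d -> 0 <= q ->
  (forall t, t \in `[t0, t0 + e] -> euclid (gamma t - gamma t0) <= 2 * e) ->
  (forall t, t \in `[t0, t0 + e] -> sqnorm (gamma t) <= sqnorm (gamma t0) + 2 * q) ->
  (arc_potential gamma t0 (t0 + e) y <= logkernel (gamma t0) y + (4 * e / d + q)%:E +
    ((ln 4 + 8 / c) * (euclid (y - gamma t0) < d)%R%:R)%:E)%E.
Proof.
move=> ga d0 ed q0 hg hq; have [mg t0e c0 _] := ga.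
have e0 : 0 < e by move: t0e; rewrite ltrDl.
have l4 : 0 <= ln 4 :> R by rewrite ltW// ln_gt0// ltr1n.
have ee : t0 + e - t0 = e by rewrite addrC addKr.
have lene : leb `[t0, t0 + e] = e%:E.
  by rewrite lebesgue_measure_itv/= lte_fin t0e -EFinD ee.
have near t : t \in `[t0, t0 + e] ->
    euclid (y - gamma t0) - 2 * e <= euclid (y - gamma t).
  move=> tt; have := euclid_triangle (gamma t) y (gamma t0).
  by have := hg t tt; lra.
rewrite /arc_potential ee muleC lee_pdivrMr//.
have mker : measurable_fun `[t0, t0 + e] (fun t => logkernel y (gamma t)).
  by apply: measurable_funTS; exact: measurable_logkernel.
have kE t : t \in `[t0, t0 + e] -> forall (X : \bar R), (0 <= X)%E ->
   (neglog (euclid (y - gamma t)%R) <= neglog (euclid (y - gamma t0)%R) + X)%E ->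
   (logkernel y (gamma t) <= logkernel (gamma t0) y + q%:E + X)%E.
  move=> tt X X0 h; rewrite /logkernel (euclidC (gamma t0) y).
  have qt := hq t tt.
  apply: (@le_trans _ _ ((neglog (euclid (y - gamma t0)%R) + X) + ((sqnorm y + (sqnorm (gamma t0) + 2 * q)) / 2)%:E)%E).
    by rewrite leeD// lee_fin; lra.
  have -> : ((sqnorm y + (sqnorm (gamma t0) + 2 * q)) / 2) = (sqnorm (gamma t0) + sqnorm y) / 2 + q by field.
  by rewrite EFinD -!addeA leeD2l// addeC -addeA.
case: (ltP (euclid (y - gamma t0)) d) => [rd|dr] /=.
  rewrite mulr1.
  have md : measurable_fun setT (fun t => dyadic_count e (euclid (y - gamma t)%R)).
    by apply: measurable_dyadic_count; exact: measurable_euclidB.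
  have K0 : (0 <= logkernel (gamma t0) y + q%:E + (ln 4)%:E)%E.
    by rewrite adde_ge0 ?lee_fin// adde_ge0 ?lee_fin// logkernel_ge0.
  apply: (@le_trans _ _ (\int[leb]_(t in `[t0, (t0 + e)%R])
     (logkernel (gamma t0) y + q%:E + (ln 4)%:E + dyadic_count e (euclid (y - gamma t)%R)))%E).
    apply: ge0_le_integral => //.
    - by move=> t _; exact: logkernel_ge0.
    - by apply: measurable_funTS; exact: emeasurable_funD.
    - move=> t tt; rewrite -[leRHS]addeA; apply: kE => //.
        by rewrite adde_ge0// dyadic_count_ge0.
      by apply: neglog_shift_near; rewrite ?euclid_ge0//; exact: near.
  rewrite ge0_integralD//; last 2 first.
  - by move=> t _; exact: dyadic_count_ge0.
  - exact: measurable_funTS.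
  rewrite integral_cst//= lene.
  apply: (le_trans (leeD2l _ (integral_dyadic_count_arc y ga e0))).
  have -> : (8 * e / c)%:E = ((8 / c)%:E * e%:E)%E by rewrite -EFinM mulrAC.
  rewrite -ge0_muleDl// ?lee_fin ?divr_ge0 ?(ltW c0)//.
  rewrite lee_wpmul2r ?lee_fin ?(ltW e0)//.
  have ed0 : 0 <= 4 * e / d by rewrite ltW// divr_gt0// mulr_gt0.
  case: (logkernel (gamma t0) y) (logkernel_ge0 (gamma t0) y) => [k| |]// _.
  by rewrite -!EFinD lee_fin; lra.
rewrite mulr0 adde0.
apply: (@le_trans _ _ (\int[leb]_(t in `[t0, (t0 + e)%R])
     (logkernel (gamma t0) y + (4 * e / d + q)%:E))%E).
  apply: ge0_le_integral => //.
  - by move=> t _; exact: logkernel_ge0.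
  - move=> t tt; rewrite (addrC (_ / _)) EFinD addeA.
    have ed0 : 0 <= 4 * e / d by rewrite ltW// divr_gt0// mulr_gt0.
    by apply: kE => //; apply: (neglog_shift_far e0 d0 dr ed); exact: near.
by rewrite integral_cst//= lene.
Qed.

End shrinking_arcs.

(** * Variation towards a point of the curve *)

Section point_variation.
Variable R : realType.
Local Notation plane := (R * R)%type.
Implicit Types (x y z : plane) (mu : probability (R * R)%type R).

Lemma mean_arc_potential_shrink mu gamma t0 e c d q M :
  expanding_arc gamma t0 (t0 + e) c -> 0 < d -> 4 * e <= d -> 0 <= q ->
  (forall t, t \in `[t0, t0 + e] -> euclid (gamma t - gamma t0) <= 2 * e) ->
  (forall t, t \in `[t0, t0 + e] -> sqnorm (gamma t) <= sqnorm (gamma t0) + 2 * q) ->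
  0 <= M -> (forall t, t \in `[t0, t0 + e] -> sqnorm (gamma t) <= M) ->
  (\int[mu]_y arc_potential gamma t0 (t0 + e) y <=
   potential mu (gamma t0) + (4 * e / d + q)%:E +
    (ln 4 + 8 / c)%:E * mu (disk (gamma t0) d))%E.
Proof.
move=> ga d0 ed q0 hg hq M0 hM; have [mg t0e c0 _] := ga.
have e0 : 0 < e by move: t0e; rewrite ltrDl.
have l4 : 0 <= ln 4 :> R by rewrite ltW// ln_gt0// ltr1n.
have k0 : 0 <= ln 4 + 8 / c by rewrite addr_ge0// divr_ge0// ltW.
have k1 : 0 <= 4 * e / d + q by rewrite addr_ge0// divr_ge0// ltW// mulr_gt0.
have mk : measurable_fun setT (logkernel (gamma t0)) by exact: measurable_logkernel.
have md : measurable_fun setT (fun y : plane =>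
    ((ln 4 + 8 / c) * (euclid (y - gamma t0) < d)%R%:R)%:E : \bar R).
  apply/measurable_EFinP; apply: measurable_funM => //.
  by apply: measurable_ltr_indic; exact: measurable_euclidB.
rewrite -integral_disk//.
have -> : (potential mu (gamma t0) + (4 * e / d + q)%:E =
    \int[mu]_y (logkernel (gamma t0) y + (4 * e / d + q)%:E))%E.
  rewrite ge0_integralD//; last by move=> y _; exact: logkernel_ge0.
  by rewrite integral_cst_probability ?lee_fin.
have K0 y : (0 <= logkernel (gamma t0) y + (4 * e / d + q)%:E)%E.
  by rewrite adde_ge0 ?lee_fin// logkernel_ge0.
rewrite -ge0_integralD//; last 2 first.
- exact: emeasurable_funD.
- by move=> y _; rewrite lee_fin mulr_ge0.
apply: ge0_le_integral => //.
- by move=> y _; apply: arc_potential_ge0; exact: ltW.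
- exact: (measurable_arc_potential ga M0 hM).
- by apply: emeasurable_funD => //; exact: emeasurable_funD.
- by move=> y _; exact: arc_potential_shrink.
Qed.

(** On the disk of radius exp(-N) the kernel is at least N; in particular a
    point of finite potential carries no mass. *)
Lemma potential_disk mu x (N : nat) :
  (N%:R%:E * mu (disk x (expR (- N%:R))) <= potential mu x)%E.
Proof.
rewrite -integral_disk//; apply: ge0_le_integral => //.
- apply/measurable_EFinP; apply: measurable_funM => //.
  by apply: measurable_ltr_indic; exact: measurable_euclidB.
- exact: measurable_logkernel.
move=> y _; case: (ltP (euclid (y - x)) (expR (- N%:R))) => [yx|_] /=; last first.
  by rewrite mulr0 logkernel_ge0.
rewrite mulr1; apply: le_trans (neglog_le_logkernel x y); rewrite euclidC.
apply: (@le_trans _ _ (neglog (expR (- N%:R)))).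
  by rewrite neglogE ?expR_gt0// expRK opprK.
by apply: le_neglog; rewrite ?euclid_ge0// ltW.
Qed.

(** Use the arcs of the curve that start at gamma t0 and let their length tend
    to 0.  The disk of radius d, on which the potential of the arc is only
    bounded by a constant, is chosen first so as to have small mass; the length
    e of the arc is then small with respect to d. *)
Lemma point_variation mu (S A : set plane) (m : R)
    (gamma : R -> plane) (t0 c eta : R) :
  measurable S -> measurable A ->
  is_minimizer (@log_energy R) (constrained_measures S m) mu ->
  (log_energy mu < +oo)%E ->
  measurable_fun setT gamma -> range gamma `<=` S ->
  (forall s t, euclid (gamma s - gamma t) <= 2 * `|s - t|) ->
  0 < c -> 0 < eta ->
  {in `[t0, t0 + eta] &, forall s t, c * `|s - t| <= euclid (gamma s - gamma t)} ->
  (potential mu (gamma t0) < +oo)%E ->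
  (\int[mu]_(x in A) potential mu x <= mu A * potential mu (gamma t0))%E.
Proof.
move=> mS mA mumin muoo mg gS lip c0 eta0 hg Poo.
set x0 := gamma t0.
have [p Pp p0] : exists2 p, potential mu x0 = p%:E & 0 <= p.
  by apply: ge0_fin => //; exact: potential_ge0.
have l4 : 0 <= ln 4 :> R by rewrite ltW// ln_gt0// ltr1n.
set k := ln 4 + 8 / c.
have k0 : 0 <= k by rewrite addr_ge0// divr_ge0// ltW.
apply/lee_addgt0Pr => th th0.
have [N hN] : exists N : nat, 2 * k * p / th < N%:R.
  by exists (Num.truncn (2 * k * p / th)).+1; exact: truncnS_gt.
have N0 : 0 < N%:R :> R.
  by apply: le_lt_trans hN; rewrite divr_ge0 ?(ltW th0)// mulr_ge0// mulr_ge0.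
set d := expR (- N%:R : R).
have d0 : 0 < d by exact: expR_gt0.
set Q := 4 / d + 2 * (euclid x0 + 1).
have Q0 : 0 < Q.
  by rewrite addr_gt0 ?divr_gt0// mulr_gt0// ltr_wpDl ?euclid_ge0.
pose e := Num.min eta (Num.min 1 (Num.min (d / 4) (th / 2 / Q))).
have e0 : 0 < e by rewrite !lt_min eta0 ltr01 !divr_gt0.
have eeta : e <= eta by rewrite ge_min lexx.
have e1 : e <= 1 by rewrite /e !ge_min lexx orbT.
have ed : 4 * e <= d by rewrite mulrC -ler_pdivlMr// /e !ge_min lexx !orbT.
have eQ : e * Q <= th / 2 by rewrite -ler_pdivlMr// /e !ge_min lexx !orbT.
pose q := 2 * e * euclid x0 + 2 * e ^+ 2.
have q0 : 0 <= q by rewrite addr_ge0// !mulr_ge0 ?sqr_ge0 ?euclid_ge0// ltW.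
have sub t : t \in `[t0, t0 + e] -> t \in `[t0, t0 + eta].
  by rewrite !in_itv/= => /andP[-> h]; rewrite (le_trans h)// lerD2l.
have ga : expanding_arc gamma t0 (t0 + e) c.
  split => //; first by rewrite ltrDl.
  by move=> s t /sub hs /sub ht; exact: hg.
have near t : t \in `[t0, t0 + e] -> euclid (gamma t - x0) <= 2 * e.
  rewrite in_itv/= => /andP[t0t tt]; apply: (le_trans (lip _ _)).
  by rewrite ler_pM2l// ger0_norm; lra.
have hq t : t \in `[t0, t0 + e] -> sqnorm (gamma t) <= sqnorm x0 + 2 * q.
  move=> /near h; rewrite -!sqr_euclid.
  have := ler_euclidD (gamma t - x0) x0; rewrite subrK => h1.
  have h2 : euclid (gamma t) <= euclid x0 + 2 * e by lra.
  apply: (@le_trans _ _ ((euclid x0 + 2 * e) ^+ 2)).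
    by rewrite lerXn2r ?nnegrE ?euclid_ge0// addr_ge0 ?euclid_ge0// mulr_ge0// ltW.
  by rewrite /q le_eqVlt; apply/orP; left; apply/eqP; ring.
have M0 : 0 <= sqnorm x0 + 2 * q by rewrite addr_ge0 ?sqnorm_ge0// mulr_ge0.
have := arc_variation mS mA mumin muoo ga M0 hq (or_intror (fun t _ => gS _ (ex_intro2 _ _ t I erefl))).
move=> /le_trans; apply.
have mean := mean_arc_potential_shrink mu ga d0 ed q0 near hq M0 hq.
have hd := potential_disk mu x0 N; rewrite -/d in hd.
have [r Dr r0] : exists2 r, mu (disk x0 d) = r%:E & 0 <= r.
  by apply: ge0_fin => //; rewrite -ge0_fin_numE// fin_num_measure//; exact: measurable_disk.
have [mm Am mm0] : exists2 r, mu A = r%:E & 0 <= r.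
  by apply: ge0_fin => //; rewrite -ge0_fin_numE// fin_num_measure.
have mm1 : mm <= 1 by rewrite -lee_fin -Am probability_le1.
move: mean hd; rewrite -/x0 Pp Dr Am -/k => mean; rewrite -EFinM lee_fin => hd.
apply: (le_trans (lee_wpmul2l _ mean)); first by rewrite lee_fin.
rewrite -?EFinM -?EFinD -?EFinM -?EFinD lee_fin.
have kr : k * r <= th / 2.
  have : 2 * k * p < N%:R * th by rewrite -ltr_pdivrMr.
  have : 2 * k * (N%:R * r) <= 2 * k * p by rewrite ler_wpM2l// mulr_ge0.
  move=> h1 h2; have {}h : N%:R * (2 * (k * r)) <= N%:R * th by lra.
  by move: h; rewrite ler_pM2l//; lra.
have qe : 4 * e / d + q <= th / 2.
  apply: le_trans eQ; rewrite /q /Q.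
  have : e ^+ 2 <= e by rewrite expr2 ler_piMl// ltW.
  have -> : e * (4 / d + 2 * (euclid x0 + 1)) = 4 * e / d + (2 * e * euclid x0 + 2 * e).
    by ring.
  lra.
have : mm * (4 * e / d + q + k * r) <= 1 * th.
  have ed0 : 0 <= 4 * e / d by rewrite divr_ge0 ?mulr_ge0 ?(ltW d0) ?(ltW e0).
  have kr0 : 0 <= k * r by rewrite mulr_ge0.
  apply: ler_pM => //; lra.
lra.
Qed.

End point_variation.

(** * Arc-length parametrized curves *)

Section curve_geometry.
Variable R : realType.
Local Notation plane := (R * R)%type.
Implicit Types (G : R -> plane) (u v : plane).

Lemma sqnormB_dot u v : sqnorm (u - v) = sqnorm u + sqnorm v - 2 * dot v u.
Proof. by rewrite /sqnorm /dot /=; ring. Qed.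

Lemma is_derive_fst G t : derivable G t 1 ->
  is_derive t 1 (fun s => (G s).1) (derive1 G t).1.
Proof.
move=> dG; rewrite derive1E /derive.
pose F := fun h : R => h^-1 *: ((G \o shift t) (h *: 1) - G t).
have h : (fst \o F) @ 0^' --> (lim (F @ 0^')).1.
  by apply: cvg_comp; [exact: dG|exact: cvg_fst].
by split; [exact: (cvgP _ h)|exact: cvg_lim h].
Qed.

Lemma is_derive_snd G t : derivable G t 1 ->
  is_derive t 1 (fun s => (G s).2) (derive1 G t).2.
Proof.
move=> dG; rewrite derive1E /derive.
pose F := fun h : R => h^-1 *: ((G \o shift t) (h *: 1) - G t).
have h : (snd \o F) @ 0^' --> (lim (F @ 0^')).2.
  by apply: cvg_comp; [exact: dG|exact: cvg_snd].
by split; [exact: (cvgP _ h)|exact: cvg_lim h].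
Qed.

Lemma is_derive_dot G t u : derivable G t 1 ->
  is_derive t 1 (fun s => dot u (G s)) (dot u (derive1 G t)).
Proof.
move=> dG; have d1 := is_derive_fst dG; have d2 := is_derive_snd dG.
rewrite /dot.
have -> : (fun s => u.1 * (G s).1 + u.2 * (G s).2) =
  (u.1 *: (fun s => (G s).1)) + (u.2 *: (fun s => (G s).2)) by [].
by apply: is_deriveD; apply: is_deriveZ.
Qed.

(** The mean value theorem holds for the components of the curve, not for the
    curve itself. *)
Lemma dot_mvt G u s t : (forall t, derivable G t 1) -> s < t ->
  exists2 c, c \in `]s, t[ &
    dot u (G t) - dot u (G s) = dot u (derive1 G c) * (t - s).
Proof.
move=> dG st.
have [||c cst e] := @MVT R (fun s => dot u (G s)) (fun c => dot u (derive1 G c)) s t st.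
- by move=> c _; exact: is_derive_dot.
- apply: continuous_subspaceT => c.
  by apply/differentiable_continuous/derivable1_diffP; have [] := is_derive_dot u (dG c).
- by exists c.
Qed.

Lemma dotBr u v w : dot u (v - w) = dot u v - dot u w.
Proof. by rewrite /dot /=; ring. Qed.

Lemma arc_length_lipschitz G s t : arc_length_parametrized G ->
  euclid (G s - G t) <= 2 * `|s - t|.
Proof.
move=> aG; have dG c : derivable G c 1 by have [] := aG c.
wlog st : s t / s < t => [hw|].
  case: (ltgtP s t) => [/hw//|/hw h|->].
    by rewrite euclidC distrC.
  by rewrite !subrr normr0 mulr0 euclid0.
have comp u : sqnorm u = 1 -> `|dot u (G t - G s)| <= t - s.
  move=> u1; have [c _ e] := dot_mvt u dG st.
  rewrite dotBr e normrM (@ger0_norm _ (t - s)) ?subr_ge0 ?(ltW st)//.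
  rewrite ler_piMl ?subr_ge0 ?(ltW st)//.
  rewrite (le_trans (dot_le _ _))// (aG c).2 mulr1.
  by rewrite /euclid -/(sqnorm u) u1 sqrtr1.
rewrite euclidC distrC (le_trans (euclid_le _))// (@gtr0_norm _ (t - s)) ?subr_gt0//.
have := comp (1, 0); have := comp (0, 1); rewrite /dot /sqnorm /= !mul0r !mul1r add0r addr0 expr0n expr1n /= add0r addr0.
by move=> /(_ erefl) h1 /(_ erefl) h2; rewrite /=; lra.
Qed.

(** By the continuity of the unit tangent u(t), the scalar product
    <u(t), u(t0)> = 1 - |u(t) - u(t0)|^2 / 2 is at least 1/2 near t0, so the
    component of the curve along u(t0) increases at speed at least 1/2. *)
Lemma arc_length_expanding G alpha t0 : 0 < alpha ->
  arc_length_parametrized G -> C1_holder alpha G ->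
  exists2 eta, 0 < eta &
   {in `[t0, t0 + eta] &, forall s t, 2^-1 * `|s - t| <= euclid (G s - G t)}.
Proof.
move=> alpha0 aG [_ [C hC]].
have dG c : derivable G c 1 by have [] := aG c.
have [eta eta0 heta] : exists2 eta, 0 < eta & forall t, t \in `[t0, t0 + eta] ->
    euclid (derive1 G t - derive1 G t0) <= 1.
  pose C1 := Num.max C 1.
  have C10 : 0 < C1 by rewrite lt_max ltr01 orbT.
  exists (C1^-1 `^ alpha^-1); first by rewrite powR_gt0// invr_gt0.
  move=> t; rewrite in_itv/= => /andP[t0t tt]; apply: (le_trans (hC _ _)).
  apply: (@le_trans _ _ (C1 * `|t - t0| `^ alpha)).
    by rewrite ler_wpM2r ?powR_ge0// le_max lexx.
  rewrite mulrC -ler_pdivlMr// mul1r.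
  rewrite -[leRHS]powRr1 ?invr_ge0 ?(ltW C10)// -(mulVf (lt0r_neq0 alpha0)) powRrM.
  rewrite ge0_ler_powR ?nnegrE ?powR_ge0 ?(ltW alpha0)//.
  by rewrite ger0_norm; lra.
exists eta => // s t; wlog st : s t / s < t => [hw|sab tab].
  case: (ltgtP s t) => [/hw h|/hw h sab tab|-> _ _].
  - exact: h.
  - by rewrite euclidC distrC; exact: h.
  - by rewrite subrr normr0 mulr0 euclid_ge0.
set u := derive1 G t0.
have u1 : euclid u = 1 by exact: (aG t0).2.
have [c cst e] := dot_mvt u dG st.
have cab : c \in `[t0, t0 + eta].
  move: cst sab tab; rewrite !in_itv/=; lra.
have hdot : 2^-1 <= dot u (derive1 G c).
  have := heta c cab; have := euclid_ge0 (derive1 G c - u).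
  have e1 := sqr_euclid (derive1 G c - u).
  have e2 := sqr_euclid (derive1 G c); rewrite (aG c).2 in e2.
  have e3 := sqr_euclid u; rewrite u1 in e3.
  have e4 := sqnormB_dot (derive1 G c) u.
  move=> h0 h1; have : euclid (derive1 G c - u) ^+ 2 <= 1 by rewrite expr_le1.
  rewrite e1 e4 -e2 -e3 expr1n; move: (dot _ _); clear => z; lra.
rewrite euclidC distrC gtr0_norm ?subr_gt0//.
have := dot_le u (G t - G s); rewrite u1 mul1r; apply: le_trans.
rewrite dotBr e; apply: le_trans (ler_norm _).
by rewrite ler_wpM2r// subr_ge0 ltW.
Qed.

End curve_geometry.

(** * Topology of the plane and separation *)

Section plane_topology.
Variable R : realType.
Local Notation plane := (R * R)%type.
Implicit Types (x y : plane) (U : set plane).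

Lemma nbhs_disk x r : 0 < r -> nbhs x (disk x r).
Proof.
move=> r0; apply/nbhs_ballP; exists (r / 2) => /=; first by rewrite divr_gt0.
move=> y [/= h1 h2]; rewrite /disk /= (le_lt_trans (euclid_le _))//=.
by move: h1 h2; rewrite /ball /= (distrC x.1) (distrC x.2); lra.
Qed.

Lemma nbhs_disk_sub x U : nbhs x U -> exists2 r, 0 < r & disk x r `<=` U.
Proof.
move=> /nbhs_ballP[e /= e0 eU]; exists e => // y; rewrite /disk /= => yx.
apply: eU; split; rewrite /ball /= distrC.
  exact: le_lt_trans (euclid_fst (y - x)) yx.
exact: le_lt_trans (euclid_snd (y - x)) yx.
Qed.

Lemma open_disk x r : open (disk x r).
Proof.
move=> y yx; have r0 : 0 < r - euclid (y - x) by rewrite subr_gt0.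
apply: filterS (nbhs_disk y r0) => z zy.
rewrite /disk /= (le_lt_trans (euclid_triangle y _ _))//.
by move: zy; rewrite /disk /=; lra.
Qed.

(** Every open set is the union of the disks with rational center and radius
    1/(n+1) that it contains. *)
Lemma open_measurable_plane U : open U -> measurable U.
Proof.
move=> oU.
pose D (q : (rat * rat) * nat) : set plane :=
  if `[< disk (ratr q.1.1, ratr q.1.2) (q.2.+1%:R^-1) `<=` U >]
  then disk (ratr q.1.1, ratr q.1.2) (q.2.+1%:R^-1) else set0.
rewrite (_ : U = \bigcup_n (if unpickle n is Some q then D q else set0)); last first.
  apply/seteqP; split=> [x Ux|x [n _]]; last first.
    case: unpickle => // q; rewrite /D; case: asboolP => // h; exact: h.
  have [r r0 rU] := nbhs_disk_sub (oU x Ux).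
  have [n nr] : exists n : nat, 2 * n.+1%:R^-1 < r.
    exists (Num.truncn (2 / r)); rewrite ltr_pdivrMr// mulrC -ltr_pdivrMr//.
    exact: truncnS_gt.
  have v0 : 0 < n.+1%:R^-1 :> R by rewrite invr_gt0.
  set v := n.+1%:R^-1 in nr v0.
  have [p hp] : exists p : rat, `|x.1 - ratr p| < v / 2.
    have /rat_in_itvoo[p] : x.1 - v / 2 < x.1 + v / 2 by lra.
    by rewrite in_itv/= => ?; exists p; rewrite distrC ltr_distl.
  have [q hq] : exists p : rat, `|x.2 - ratr p| < v / 2.
    have /rat_in_itvoo[q] : x.2 - v / 2 < x.2 + v / 2 by lra.
    by rewrite in_itv/= => ?; exists q; rewrite distrC ltr_distl.
  have hx : disk (ratr p, ratr q) v x.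
    by rewrite /disk /= (le_lt_trans (euclid_le _))//=; lra.
  exists (pickle ((p, q), n)); first exact: I.
  rewrite pickleK /D -/v /=; case: asboolP => [_|[]]; first exact: hx.
  move=> z hz; apply: rU; rewrite /disk /= (le_lt_trans (euclid_triangle (ratr p, ratr q) _ _))//.
  by rewrite (euclidC _ x); move: hz hx; rewrite /disk /=; lra.
apply: bigcupT_measurable => n; case: unpickle => // q; rewrite /D.
by case: asboolP => // _; exact: measurable_disk.
Qed.

Lemma closed_measurable_plane U : closed U -> measurable U.
Proof.
by move=> /closed_openC/open_measurable_plane/measurableC; rewrite setCK.
Qed.

Lemma compact_closed_plane U : compact U -> closed U.
Proof. by apply: compact_closed; exact: norm_hausdorff. Qed.

Definition box (r : R) : set plane := `[- r, r] `*` `[- r, r].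

Lemma compact_box r : compact (box r).
Proof. by apply: compact_setX; exact: segment_compact. Qed.

Lemma euclid_box x r : euclid x <= r -> box r x.
Proof.
move=> xr; split; rewrite /= in_itv/= -ler_norml;
  by [apply: le_trans xr; exact: euclid_fst|apply: le_trans xr; exact: euclid_snd].
Qed.

(** Only the part of S in a large box matters, and there compactness makes the
    radius of separation uniform. *)
Lemma uniform_separation (S F : set plane) (B : R) : closed S ->
  (forall y, F y -> euclid y <= B) ->
  (forall x, S x -> exists2 r, 0 < r & disk x r `&` F = set0) ->
  (0 < dist S F)%E.
Proof.
move=> cS FB hS.
have cK : compact (S `&` box (B + 1)).
  by rewrite setIC; apply: compact_closedI => //; exact: compact_box.
have := (@compact_near_coveringP _ _).1 cK.
move=> /(_ R (at_right 0) (fun e x => disk x e `&` F = set0) _).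
case.
  move=> x [/hS[r r0 rF] _].
  exists (disk x (r / 2), [set e | e <= r / 2]); first split => /=.
  - by apply: nbhs_disk; rewrite divr_gt0.
  - by apply: nbhs_right_le; rewrite divr_gt0.
  - move=> [y e] [/= yx er]; rewrite -subset0 => z [zy Fz].
    have : (disk x r `&` F) z; last by rewrite rF.
    split => //; rewrite /disk /= (le_lt_trans (euclid_triangle y _ _))//.
    by move: yx zy; rewrite /disk /=; lra.
move=> e0 he0 hsub.
pose e1 := Num.min (e0 / 2) 1.
have e00 : 0 < e0 by [].
have e10 : 0 < e1 by rewrite lt_min ltr01 divr_gt0.
apply: (@lt_le_trans _ _ e1%:E); first by rewrite lte_fin.
rewrite /dist; apply: le_ereal_inf_tmp => _ [x Sx [y Fy <-]]; rewrite lee_fin leNgt; apply/negP => xy.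
have h1 : euclid (x - y) < 1 by apply: lt_le_trans xy _; rewrite ge_min lexx orbT.
have h2 : euclid (x - y) < e0 / 2 by apply: lt_le_trans xy _; rewrite ge_min lexx.
have Kx : (S `&` box (B + 1)) x.
  split => //; apply: euclid_box.
  have := euclid_triangle y x 0; rewrite !subr0.
  by have := FB y Fy; lra.
have e02 : 0 < e0 / 2 by rewrite divr_gt0.
have := hsub (e0 / 2) _ e02 x Kx.
rewrite /= sub0r normrN gtr0_norm// => /(_ _) h.
have : (disk x (e0 / 2) `&` F) y by split => //; rewrite /disk /= euclidC.
rewrite h//; lra.
Qed.

End plane_topology.

(** * Curves of locally finite length are closed *)

Section closed_range.
Variable R : realType.
Local Notation plane := (R * R)%type.
Implicit Types (G : R -> plane).
Local Notation leb := (@lebesgue_measure R).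

Lemma lipschitz_continuous G :
  (forall s t, euclid (G s - G t) <= 2 * `|s - t|) -> continuous G.
Proof.
move=> lip t U /nbhs_disk_sub[r r0 rU].
apply/nbhs_ballP; exists (r / 2) => /=; first by rewrite divr_gt0.
move=> s /=; rewrite /ball /= => ts; apply: rU; rewrite /disk /=.
by rewrite (le_lt_trans (lip _ _))// distrC; lra.
Qed.

Lemma compact_arc G (a b : R) : continuous G -> compact (G @` `[a, b]).
Proof.
move=> cG; apply: continuous_compact; last exact: segment_compact.
exact: continuous_subspaceT.
Qed.

(** A parameter is brought into [0,p] by finitely many periods. *)
Lemma range_periodic G p : 0 < p -> (forall u, G (u + p) = G u) ->
  range G = G @` `[0, p].
Proof.
move=> p0 pG; apply/seteqP; split => [_ [u _ <-]|_ [u _ <-]]; last by exists u.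
have per n u' : G (u' + n%:R * p) = G u'.
  elim: n u' => [|n IH] u'; first by rewrite mul0r addr0.
  by rewrite -natr1 mulrDl mul1r addrA pG IH.
wlog u0 : u / 0 <= u => [hw|].
  have [n hn] : exists n : nat, - u / p < n%:R.
    by exists (Num.truncn (- u / p)).+1; exact: truncnS_gt.
  rewrite -(per n u); apply: hw.
  by move: hn; rewrite ltr_pdivrMr//; lra.
have [n hn] : exists n : nat, u / p < n%:R.
  by exists (Num.truncn (u / p)).+1; exact: truncnS_gt.
rewrite ltr_pdivrMr// in hn.
elim: n u u0 hn => [|n IH] u u0 hn; first by move: hn; rewrite mul0r; lra.
have [up|pu] := leP u p; first by exists u => //=; rewrite in_itv/= u0.
have -> : G u = G (u - p) by rewrite -[in LHS](subrK p u) pG.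
apply: IH; first by lra.
by move: hn; rewrite -natr1 mulrDl mul1r; lra.
Qed.

(** Visits at parameters further and further away give disjoint unit intervals
    of parameters that stay in K. *)
Lemma far_returns_infinite_length G (K : set plane) :
  continuous G -> injective G -> compact K ->
  (forall M : R, exists2 t : R, M < `|t| & forall s, s \in `[t, t + 1] -> K (G s)) ->
  length_in G K = +oo%E.
Proof.
move=> cG iG cK hK.
have cE : closed (G @^-1` K).
  apply: preimage_closed; first by move=> x _; exact: cG.
  exact: compact_closed_plane.
have mE : measurable (G @^-1` K) by exact: closed_measurable.
have step n : exists2 M : R, 0 <= M & (n%:R%:E <= leb (G @^-1` K `&` `[(- M)%R, M]))%E.
  elim: n => [|n [M M0 IH]]; first by exists 0 => //; exact: measure_ge0.
  have [t Mt tK] := hK (M + 1).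
  exists (M + `|t| + 1); first by rewrite !addr_ge0.
  apply: (@le_trans _ _ (leb ((G @^-1` K `&` `[- M, M]) `|` `[t, t + 1]))); last first.
    apply: le_measure; rewrite ?inE.
    - by apply: measurableU => //; exact: measurableI.
    - exact: measurableI.
    - move=> s [[Ks]|] /=; rewrite in_itv/= => sM.
        by split => //=; rewrite in_itv/=; have := normr_ge0 t; lra.
      split; first by apply: tK; rewrite in_itv.
      rewrite /= in_itv/=; have := ler_norm t; have := ler_norm (- t); rewrite normrN; lra.
  rewrite measureU//; last 2 first.
  - exact: measurableI.
  - rewrite -subset0 => s [[_ /=]]; rewrite !in_itv/= => h1 h2.
    move: Mt; rewrite ltNge => /negP; apply; rewrite ler_norml; lra.
  have len1 : leb `[t, t + 1] = 1%:E.
    by rewrite lebesgue_measure_itv/= lte_fin ltrDl ltr01 -EFinD addrC addKr.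
  by rewrite -natr1 EFinD leeD// -len1.
apply/eqyP => r r0.
have [M M0 hM] := step (Num.truncn r).+1.
apply: (@le_trans _ _ (Num.truncn r).+1%:R%:E).
  by rewrite lee_fin ltW// truncnS_gt.
apply: (le_trans hM); apply: ereal_sup_ubound.
exists (G @^-1` K `&` `[- M, M]) => //; split.
- exact: measurableI.
- by move=> s t _ _; exact: iG.
- by move=> s [].
Qed.

(** A closed curve is compact.  An open one tends to infinity at both ends:
    each return of a curve of speed at most 2 into the unit disk around x keeps
    it for a unit time in a fixed box, and too many returns would give infinite
    length there. *)
Lemma closed_range G :
  (forall s t, euclid (G s - G t) <= 2 * `|s - t|) ->
  no_self_intersection G -> locally_finite_length G -> closed (range G).
Proof.
move=> lip nsi lfl.
have cG := lipschitz_continuous lip.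
have [iG|] := pselect (injective G); last first.
  move=> /existsNP[s /existsNP[t /not_implyP[Gst st]]].
  have [p p0 pG] : exists2 p, 0 < p & forall u, G (u + p) = G u.
    have [] := ltgtP s t => // ts.
    - by exists (t - s); [rewrite subr_gt0|exact: nsi].
    - by exists (s - t); [rewrite subr_gt0|apply: nsi; rewrite Gst].
  by rewrite (range_periodic p0 pG); apply: compact_closed_plane; exact: compact_arc.
move=> x clx.
pose K := box (euclid x + 3).
have [[M hM]|unb] := pselect (exists M, forall t, euclid (G t - x) < 1 -> `|t| <= M).
  have : closed (G @` `[- M, M]) by apply: compact_closed_plane; exact: compact_arc.
  have : closure (G @` `[- M, M]) x.
    move=> U xU; have xU1 : nbhs x (U `&` disk x 1).
      by apply: filterI => //; exact: nbhs_disk.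
    have [_ [[t _ <-] [Ut xt]]] := clx _ xU1.
    exists (G t); split => //; exists t => //=.
    by rewrite in_itv/= -ler_norml; exact: hM.
  by move=> h /(_ _ h)[t _ <-]; exists t.
have := lfl K (@compact_box R _).
rewrite (far_returns_infinite_length cG iG (@compact_box R _))// => M.
apply: contrapT => h; apply: unb; exists M => t xt; rewrite leNgt; apply/negP => Mt.
apply: h; exists t => // s; rewrite in_itv/= => sab; apply: euclid_box.
have := ler_euclidD (G s - G t) ((G t - x) + x).
have := ler_euclidD (G t - x) x.
rewrite !subrK; have := lip s t.
have : `|s - t| <= 1 by rewrite ler_norml; lra.
lra.
Qed.

End closed_range.

(** * Lower semicontinuity of the potential *)

Section semicontinuity.
Variable R : realType.
Local Notation plane := (R * R)%type.
Implicit Types (x y : plane) (mu : probability (R * R)%type R).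

Lemma cvg_neglog (u : R^nat) (l : R) : (forall n, 0 <= u n) -> 0 <= l ->
  u @ \oo --> l -> (neglog (u n) @[n --> \oo] --> neglog l)%E.
Proof.
move=> u0; rewrite le_eqVlt => /predU1P[<-|l0] ul.
  rewrite neglog0; apply/cvgeyPge => A.
  have h := cvgr_lt _ ul _ (expR_gt0 (- A)).
  near=> n.
  have -> : A%:E = neglog (expR (- A)) by rewrite neglogE ?expR_gt0// expRK opprK.
  apply: le_neglog; first exact: u0.
  by apply: ltW; near: n; exact: h.
rewrite neglogE//.
have h := cvgr_gt _ ul _ l0.
apply: (@cvg_trans _ ((- ln (u n))%:E @[n --> \oo])).
  by apply: near_eq_cvg; near=> n; rewrite neglogE//; near: n; exact: h.
apply: cvg_EFin; first exact: nearW.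
by apply: cvgN; apply: continuous_cvg => //; exact: continuous_ln.
Unshelve. all: by end_near. Qed.

Lemma cvg_euclidB (x_ : nat -> plane) x y :
  (forall n, euclid (x_ n - x) < n.+1%:R^-1) ->
  euclid (x_ n - y) @[n --> \oo] --> euclid (x - y).
Proof.
move=> hx.
apply: (@squeeze_cvgr _ _ _ _ (fun n => euclid (x - y) - n.+1%:R^-1)
  (fun n => euclid (x - y) + n.+1%:R^-1)).
- apply: nearW => n; move: (hx n); move: (n.+1%:R^-1) => v hv.
  have := euclid_triangle (x_ n) x y; rewrite (euclidC x (x_ n)).
  have := euclid_triangle x (x_ n) y.
  move: (euclid (x_ n - x)) (euclid (x - y)) (euclid (x_ n - y)) hv => p q r.
  by move=> *; apply/andP; split; lra.
- rewrite -[X in _ --> X]subr0; apply: cvgB; first exact: cvg_cst.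
  exact: cvg_harmonic.
- rewrite -[X in _ --> X]addr0; apply: cvgD; first exact: cvg_cst.
  exact: cvg_harmonic.
Qed.

Lemma cvg_logkernel (x_ : nat -> plane) x y :
  (forall n, euclid (x_ n - x) < n.+1%:R^-1) ->
  logkernel (x_ n) y @[n --> \oo] --> logkernel x y.
Proof.
move=> hx; apply: cvgeD.
- by rewrite fin_num_adde_defl.
- apply: cvg_neglog; [by move=> n; exact: euclid_ge0|exact: euclid_ge0|].
  exact: cvg_euclidB.
- apply: cvg_EFin; first exact: nearW.
  apply: cvgMl; apply: cvgD; last exact: cvg_cst.
  have h := @cvg_euclidB x_ x 0 hx.
  rewrite subr0 in h.
  rewrite -sqr_euclid expr2.
  have -> : (fun n => sqnorm (x_ n)) = (fun n => euclid (x_ n - 0) * euclid (x_ n - 0)).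
    by apply/funext => n; rewrite subr0 -expr2 sqr_euclid.
  exact: cvgM.
Qed.

(** Fatou's lemma for the kernel, which is continuous with values in
    [0, +oo]. *)
Lemma potential_lsc mu x c : (c%:E < potential mu x)%E ->
  exists2 r, 0 < r & forall z, disk x r z -> (c%:E < potential mu z)%E.
Proof.
move=> cP; apply: contrapT => h.
have hx n : exists z, euclid (z - x) < n.+1%:R^-1 /\ (potential mu z <= c%:E)%E.
  apply: contrapT => hz; apply: h; exists n.+1%:R^-1; first by rewrite invr_gt0.
  move=> z zx; rewrite ltNge; apply/negP => zc; apply: hz; exists z; split => //.
have [x_ hx_] := choice hx.
have hx1 n : euclid (x_ n - x) < n.+1%:R^-1 by have [] := hx_ n.
have := @fatou _ _ _ mu setT measurableT (fun n y => logkernel (x_ n) y).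
have -> : (\int[mu]_y limn_einf (fun n => logkernel (x_ n) y) = potential mu x)%E.
  by apply: eq_integral => y _; have [-> _] := cvg_limn_einf_sup (@cvg_logkernel x_ x y hx1).
move=> /(_ _ _) fat.
have {}fat : (potential mu x <= limn_einf (fun n => potential mu (x_ n)))%E.
  apply: fat => [n|n y _]; [exact: measurable_logkernel|exact: logkernel_ge0].
have : (limn_einf (fun n => potential mu (x_ n)) <= c%:E)%E.
  rewrite limn_einf_lim; apply: lime_le; first exact: is_cvg_einfs.
  apply: nearW => n; apply: (@le_trans _ _ (potential mu (x_ n))); last by have [] := hx_ n.
  by apply: ereal_inf_lbound; exists n => //=.
by move=> /(le_trans fat); rewrite leNgt cP.
Qed.

End semicontinuity.

(** * Curves are null for measures of quadratic decay *)

Section main.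
Variable R : realType.
Local Notation plane := (R * R)%type.
Implicit Types (x y : plane) (mu : probability (R * R)%type R).

Lemma null_of_gap mu (A : set plane) (c c' : R) : measurable A ->
  c < c' -> 0 <= c' -> (forall x, A x -> (c'%:E <= potential mu x)%E) ->
  (\int[mu]_(x in A) potential mu x <= mu A * c%:E)%E -> mu A = 0%E.
Proof.
move=> mA cc' c'0 hA hint.
have h : (c'%:E * mu A <= mu A * c%:E)%E.
  apply: le_trans hint; rewrite -integral_cst//.
  apply: ge0_le_integral => //.
  by apply: measurable_funTS; exact: measurable_potential.
have [r Ar r0] : exists2 r, mu A = r%:E & 0 <= r.
  by apply: ge0_fin => //; rewrite -ge0_fin_numE// fin_num_measure.
move: h; rewrite Ar -!EFinM lee_fin => h; congr EFin; nra.
Qed.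

(** A compact piece of the curve is cut into n+1 arcs of parameter length h;
    each arc that meets Z lies in a disk of radius 3 h around a point of Z, so
    the total mass is at most (n+1) O(h^2) = O(1/n). *)
Lemma null_curve_piece mu (G : R -> plane) (Z : set plane) (M : nat) :
  (forall s t, euclid (G s - G t) <= 2 * `|s - t|) -> measurable Z ->
  (forall x r, Z x -> 0 < r -> (mu (disk x r) <= (16 * r ^+ 2)%:E)%E) ->
  mu (G @` `[- M.+1%:R, M.+1%:R] `&` Z) = 0%E.
Proof.
move=> lip mZ hZ.
have cG := lipschitz_continuous lip.
have mI a b : measurable (G @` `[a, b] `&` Z).
  apply: measurableI => //.
  by apply: closed_measurable_plane; apply: compact_closed_plane; exact: compact_arc.
set B : R := M.+1%:R.
have B0 : 0 < B by [].
have piece a b : a < b -> (mu (G @` `[a, b] `&` Z) <= (144 * (b - a) ^+ 2)%:E)%E.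
  move=> ab; have [->|/set0P[x [[t tab <-] Zx]]] := eqVneq (G @` `[a, b] `&` Z) set0.
    by rewrite measure0 lee_fin mulr_ge0// sqr_ge0.
  have r0 : 0 < 3 * (b - a) by lra.
  apply: (@le_trans _ _ (mu (disk (G t) (3 * (b - a))))).
    apply: le_measure; rewrite ?inE//; first exact: measurable_disk.
    move=> _ [[s sab <-] _]; rewrite /disk /= (le_lt_trans (lip _ _))//.
    move: sab tab; rewrite /= !in_itv/= => sab tab.
    have : `|s - t| <= b - a by rewrite ler_norml; lra.
    lra.
  apply: (le_trans (hZ _ _ Zx r0)); rewrite lee_fin; lra.
have bound n : (mu (G @` `[(- B)%R, B] `&` Z) <= (576 * B ^+ 2 / n.+1%:R)%:E)%E.
  pose h : R := 2 * B / n.+1%:R.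
  have h0 : 0 < h by rewrite divr_gt0// mulr_gt0.
  have hB : h * n.+1%:R = 2 * B by rewrite /h divfK.
  pose F i := G @` `[- B + h * i%:R, - B + h * i.+1%:R] `&` Z.
  have sub : G @` `[- B, B] `&` Z `<=` \big[setU/set0]_(i < n.+1) F i.
    move=> _ [[t tB <-] Zt]; rewrite -bigcup_mkord.
    move: tB; rewrite /= in_itv/= => /andP[Bt tB].
    have q0 : 0 <= (t + B) / h by rewrite divr_ge0 ?(ltW h0)//; lra.
    have [tBB|tBB] := eqVneq t B.
      exists n => //=; split => //; exists t => //=.
      rewrite tBB in_itv/= hB.
      have : h * n%:R <= h * n.+1%:R by rewrite ler_pM2l// ler_nat.
      by rewrite hB; lra.
    have tltB : t < B by rewrite lt_neqAle tBB.
    exists (Num.truncn ((t + B) / h)).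
      by rewrite /= truncn_lt_nat// ltr_pdivrMr// mulrC hB; lra.
    split => //; exists t => //=; rewrite in_itv/=.
    have := truncn_le ((t + B) / h); rewrite q0 => h1.
    have := truncnS_gt ((t + B) / h).
    rewrite ltr_pdivrMr// => h2; rewrite ler_pdivlMr// in h1.
    by move: h1 h2; rewrite mulrC (mulrC _ h); lra.
  have mF k : measurable (F k) by exact: mI.
  have csub := @content_subadditive _ _ _ mu _ F n.+1 (fun k _ => mF k) (mI _ _) sub.
  apply: (le_trans csub).
  apply: (@le_trans _ _ (\sum_(i < n.+1) (144 * h ^+ 2)%:E)%E).
    apply: lee_sum => i _; rewrite /F.
    have := @piece (- B + h * i%:R) (- B + h * i.+1%:R).
    have -> : - B + h * i.+1%:R - (- B + h * i%:R) = h by rewrite -natr1; ring.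
    by apply; rewrite ltrD2l ltr_pM2l// ltr_nat.
  rewrite sumEFin lee_fin sumr_const card_ord -[leLHS]mulr_natr /h.
  rewrite le_eqVlt; apply/orP; left; apply/eqP; field.
  by [].
have [r Ar r0] : exists2 r, mu (G @` `[- B, B] `&` Z) = r%:E & 0 <= r.
  by apply: ge0_fin => //; rewrite -ge0_fin_numE// fin_num_measure//; exact: mI.
rewrite Ar; congr EFin; apply/eqP; rewrite eq_le r0 andbT leNgt; apply/negP => r_gt0.
have := bound (Num.truncn (576 * B ^+ 2 / r)).
rewrite Ar lee_fin ler_pdivlMr// leNgt => /negP; apply.
by rewrite [ltRHS]mulrC -ltr_pdivrMr// truncnS_gt.
Qed.

Lemma null_curve mu (G : R -> plane) (Z : set plane) :
  (forall s t, euclid (G s - G t) <= 2 * `|s - t|) -> measurable Z ->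
  (forall x r, Z x -> 0 < r -> (mu (disk x r) <= (16 * r ^+ 2)%:E)%E) ->
  mu (range G `&` Z) = 0%E.
Proof.
move=> lip mZ hZ; have cG := lipschitz_continuous lip.
have mI a b : measurable (G @` `[a, b] `&` Z).
  apply: measurableI => //.
  by apply: closed_measurable_plane; apply: compact_closed_plane; exact: compact_arc.
have -> : range G `&` Z = \bigcup_M (G @` `[- M.+1%:R, M.+1%:R] `&` Z).
  apply/seteqP; split => [_ [[t _ <-] Zt]|_ [M _ [[t _ <-] Zt]]]; last by split => //; exists t.
  exists (Num.truncn `|t|) => //; split => //; exists t => //=.
  by rewrite in_itv/= -ler_norml ltW// truncnS_gt.
apply/eqP; rewrite eq_le measure_ge0 andbT.
apply: (@le_trans _ _ (\sum_(M <oo) mu (G @` `[(- M.+1%:R)%R, M.+1%:R] `&` Z))%E).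
  by apply: measure_sigma_subadditive => //; exact: bigcup_measurable.
rewrite eseries0// => M _ _; exact: null_curve_piece.
Qed.

End main.

(** * The gap, and the separation of the support *)

Section conclusion.
Variable R : realType.
Local Notation plane := (R * R)%type.
Implicit Types (x y : plane) (mu : probability (R * R)%type R).

Lemma measurable_lipschitz (G : R -> plane) :
  (forall s t, euclid (G s - G t) <= 2 * `|s - t|) -> measurable_fun setT G.
Proof.
move=> lip; have cG := lipschitz_continuous lip.
apply/measurable_fun_pairP; split; apply: continuous_measurable_fun => t.
  by apply: cvg_comp; [exact: cG|exact: cvg_fst].
by apply: cvg_comp; [exact: cG|exact: cvg_snd].
Qed.

Lemma potential_ge_sqnorm mu x :
  ((sqnorm x / 4 - 1)%:E <= potential mu x)%E.
Proof.
have [x0|x0] := leP (sqnorm x / 4 - 1) 0.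
  by apply: le_trans (potential_ge0 _ _); rewrite lee_fin.
have e0 : (0 <= (sqnorm x / 4 - 1)%:E)%E by rewrite lee_fin ltW.
rewrite -(integral_cst_probability mu e0).
apply: ge0_le_integral => //; first exact: measurable_logkernel.
by move=> y _; exact: logkernel_ge_sqnorm.
Qed.

Lemma arc_bounded (G : R -> plane) t0 eta :
  (forall s t, euclid (G s - G t) <= 2 * `|s - t|) -> 0 < eta ->
  exists2 M, 0 <= M & forall t, t \in `[t0, t0 + eta] -> sqnorm (G t) <= M.
Proof.
move=> lip eta0; exists ((euclid (G t0) + 2 * eta) ^+ 2); first exact: sqr_ge0.
move=> t; rewrite in_itv/= => /andP[t0t tt]; rewrite -sqr_euclid.
rewrite lerXn2r ?nnegrE ?addr_ge0 ?euclid_ge0 ?mulr_ge0 ?(ltW eta0)//.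
have := ler_euclidD (G t - G t0) (G t0); rewrite subrK.
have := lip t t0; rewrite ger0_norm ?subr_ge0//; lra.
Qed.

Lemma minimal_energy_finite mu (S : set plane) (a : R) (G : R -> plane) t0 c eta :
  measurable S -> range G `<=` S -> a <= 1 ->
  is_minimizer (@log_energy R) (constrained_measures S a) mu ->
  (forall s t, euclid (G s - G t) <= 2 * `|s - t|) -> 0 < eta ->
  expanding_arc G t0 (t0 + eta) c ->
  (log_energy mu < +oo)%E.
Proof.
move=> mS GS a1 [_ mumin] lip eta0 ga.
have [M M0 hM] := arc_bounded t0 lip eta0.
have [sigma [_ sS s2 sp]] := arc_measure_exists ga M0 hM.
apply: (@le_lt_trans _ _ (log_energy sigma)); last first.
  by rewrite log_energyE//; exact: sp.
apply: mumin; rewrite /constrained_measures /= (sS S mS) ?lee_fin//.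
by move=> t _; apply: GS; exists t.
Qed.

(** The constant k is the mean of P over some segment.  If no segment has a
    mean below P(x0), then almost every point has potential at most P(x0), and
    this is at most all the means around that point: the mass of disks decays
    quadratically, and the curve is null, a contradiction. *)
Lemma curve_potential_gap mu (G : R -> plane) (a c eta t0 : R) :
  measurable (range G) -> 0 < a ->
  is_minimizer (@log_energy R) (constrained_measures (range G) a) mu ->
  (log_energy mu < +oo)%E ->
  (forall s t, euclid (G s - G t) <= 2 * `|s - t|) -> 0 < c -> 0 < eta ->
  {in `[t0, t0 + eta] &, forall s t, c * `|s - t| <= euclid (G s - G t)} ->
  exists k : R, [/\ 0 <= k, (k%:E < potential mu (G t0))%E &
    forall A, measurable A -> A `&` range G = set0 ->
      (\int[mu]_(x in A) potential mu x <= mu A * k%:E)%E].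
Proof.
move=> mG a0 mumin muoo lip c0 eta0 hg.
have mmG : measurable_fun setT G by exact: measurable_lipschitz.
apply: contrapT => nok.
(* Otherwise P at the base point is at most its mean over every segment. *)
have seg x w r : sqnorm w = 1 -> 0 < r ->
  (potential mu (G t0) <= \int[mu]_y arc_potential (segment x w) r (2 * r) y < +oo)%E.
  move=> w1 r0; have ga := segment_expanding x w1 r0.
  have M0 : 0 <= 2 * (sqnorm x + (2 * r) ^+ 2).
    by rewrite mulr_ge0// addr_ge0 ?sqnorm_ge0 ?sqr_ge0.
  have hM t : t \in `[r, 2 * r] -> sqnorm (segment x w t) <= 2 * (sqnorm x + (2 * r) ^+ 2).
    exact: segment_bounded.
  have int0 : (0 <= \int[mu]_y arc_potential (segment x w) r (2 * r) y)%E.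
    by apply: integral_ge0 => y _; apply: arc_potential_ge0; lra.
  have intoo : (\int[mu]_y arc_potential (segment x w) r (2 * r) y < +oo)%E.
    have [sigma [pE _ _ sp]] := arc_measure_exists ga M0 hM.
    have := sp mu (log_energy_moment2 muoo); rewrite pairingC.
    by rewrite /pairing; under eq_integral do rewrite pE.
  rewrite intoo andbT leNgt; apply/negP => lt.
  have [k kE k0] := ge0_fin int0 intoo.
  apply: nok; exists k; split => //; first by rewrite -kE.
  move=> A mA AG; rewrite -kE.
  by apply: (arc_variation mG mA mumin muoo ga M0 hM); left.
have Poo : (potential mu (G t0) < +oo)%E.
  have /andP[h1 h2] := seg 0 (1, 0) 1 ltac:(rewrite /sqnorm /=; ring) ltr01.
  exact: le_lt_trans h1 h2.
have [p Pp p0] := ge0_fin (potential_ge0 mu (G t0)) Poo.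
have var A : measurable A -> (\int[mu]_(x in A) potential mu x <= mu A * p%:E)%E.
  move=> mA; rewrite -Pp.
  by apply: (point_variation mG mA mumin muoo mmG _ lip c0 eta0 hg Poo).
(* Z is the set of points of potential at most p; its complement is null. *)
pose A n := [set x | ((p + n.+1%:R^-1)%:E <= potential mu x)%E].
have mA n : measurable (A n).
  rewrite /A -[X in measurable X]setTI; apply: emeasurable_fun_c_infty => //.
  exact: measurable_potential.
have A0 n : mu (A n) = 0%E.
  apply: (@null_of_gap _ mu (A n) p (p + n.+1%:R^-1)) => //.
  - by rewrite ltrDl invr_gt0.
  - by rewrite addr_ge0.
  - exact: var.
pose Z := ~` \bigcup_n A n.
have mZ : measurable Z by apply: measurableC; exact: bigcup_measurable.
have Zp x : Z x -> (potential mu x <= p%:E)%E.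
  move=> Zx; apply/lee_addgt0Pr => e e0; rewrite leNgt; apply/negP => lt.
  apply: Zx; exists (Num.truncn e^-1) => //; rewrite /A /=.
  apply: ltW; apply: le_lt_trans lt; rewrite -EFinD lee_fin lerD2l.
  by rewrite invf_ple ?posrE// ltW// truncnS_gt.
have GZ : mu (range G `&` Z) = 0%E.
  apply: null_curve => // x r Zx r0.
  have Px := Zp x Zx.
  apply: small_density => //; first by rewrite (le_lt_trans Px)// ltry.
  move=> w s w1 s0; apply: (le_trans Px); rewrite -Pp.
  by have /andP[] := seg x w s w1 s0.
have CZ : mu (~` Z) = 0%E.
  rewrite /Z setCK; apply/eqP; rewrite eq_le measure_ge0 andbT.
  apply: (@le_trans _ _ (\sum_(n <oo) mu (A n))%E).
    by apply: measure_sigma_subadditive => //; exact: bigcup_measurable.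
  by rewrite eseries0.
have [Cmu _] := mumin.
have mCZ : measurable (~` Z) by exact: measurableC.
have le : (mu (range G) <= mu ((range G `&` Z) `|` ~` Z))%E.
  apply: le_measure; rewrite ?inE//.
    by apply: measurableU => //; exact: measurableI.
  by move=> x Gx; have [Zx|Zx] := pselect (Z x); [left|right].
have le2 : (mu ((range G `&` Z) `|` ~` Z) <= mu (range G `&` Z) + mu (~` Z))%E.
  by apply: measureU2 => //; exact: measurableI.
have := le_trans Cmu (le_trans le le2).
rewrite GZ CZ adde0.
by rewrite lee_fin leNgt a0.
Qed.

End conclusion.

Unset Implicit Arguments.
Set Strict Implicit.

Theorem corollary5p2 (R : realType) (a : R) (alpha : R) (G : R -> R * R)
    (mu : probability (R * R)%type R) :
  0 < a -> a < 1 ->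
  0 < alpha -> alpha < 1 ->
  arc_length_parametrized G ->
  C1_holder alpha G ->
  no_self_intersection G ->
  locally_finite_length G ->
  is_minimizer (@log_energy R) (constrained_measures (range G) a) mu ->
  (0 < dist (range G) (supp mu `\` range G))%E.
Proof.
move=> a0 a1 alpha0 _ aG C1G nsi lfl mumin.
have lip s t := arc_length_lipschitz s t aG.
have clG : closed (range G) by exact: closed_range.
have mG : measurable (range G) by exact: closed_measurable_plane.
have c0 : 0 < 2^-1 :> R by [].
have muoo : (log_energy mu < +oo)%E.
  have [eta eta0 hg] := arc_length_expanding 0 alpha0 aG C1G.
  apply: (@minimal_energy_finite R mu (range G) a G 0 2^-1 eta) => //; first exact: ltW.
  split => //; [exact: measurable_lipschitz|by rewrite ltrDl].
have gap t0 : exists k : R, [/\ 0 <= k, (k%:E < potential mu (G t0))%E &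
    forall A, measurable A -> A `&` range G = set0 ->
      (\int[mu]_(x in A) potential mu x <= mu A * k%:E)%E].
  have [eta eta0 hg] := arc_length_expanding t0 alpha0 aG C1G.
  exact: (curve_potential_gap mG a0 mumin muoo lip c0 eta0 hg).
(* An open set on which P exceeds k has no point of the support off the
   curve. *)
have off (U : set (R * R)) (k k' : R) : open U -> 0 <= k -> k < k' ->
    (forall x, U x -> (k'%:E <= potential mu x)%E) ->
    (forall A, measurable A -> A `&` range G = set0 ->
      (\int[mu]_(x in A) potential mu x <= mu A * k%:E)%E) ->
    U `&` (supp mu `\` range G) = set0.
  move=> oU k0 kk' hU hA; rewrite -subset0 => y [Uy [sy Gy]].
  pose A := U `&` ~` range G.
  have oA : open A by apply: openI => //; exact: closed_openC.
  have mA : measurable A by exact: open_measurable_plane.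
  have := sy A oA (conj Uy Gy); rewrite (@null_of_gap _ mu A k k') ?ltxx//.
  - exact: le_trans k0 (ltW kk').
  - by move=> x [/hU].
  - by apply: hA => //; rewrite /A -setIA setICl setI0.
have [k [k0 _ hk]] := gap 0.
(* With |z| > B the lower bound |z|^2 / 4 - 1 of the potential exceeds k. *)
pose B := 2 * (k + 2).
have B0 : 0 <= B by rewrite mulr_ge0// addr_ge0.
have oB : open [set z : R * R | B < euclid z].
  move=> z /= Bz; have r0 : 0 < euclid z - B by rewrite subr_gt0.
  apply: filterS (nbhs_disk z r0) => w; rewrite /disk /=.
  have := euclid_triangle w z 0; rewrite !subr0 (euclidC z w).
  by move=> *; lra.
apply: (@uniform_separation _ _ _ B) => //.
- move=> y Fy; rewrite leNgt; apply/negP => By.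
  have : ([set z | B < euclid z] `&` (supp mu `\` range G)) y by [].
  rewrite (@off _ k (k + 1))//.
  + by rewrite ltrDl.
  + move=> z /= Bz; apply: le_trans (potential_ge_sqnorm _ _).
    rewrite lee_fin -sqr_euclid.
    have : B ^+ 2 <= euclid z ^+ 2 by rewrite lerXn2r ?nnegrE ?euclid_ge0// ltW.
    by rewrite /B; nra.
- move=> _ [t _ <-]; have [l [l0 lP hl]] := gap t.
  have [l' ll' lP'] : exists2 l', l < l' & (l'%:E < potential mu (G t))%E.
    move: lP; case: (potential mu (G t)) => [p| |]//.
      by rewrite lte_fin => lp; exists ((l + p) / 2); rewrite ?lte_fin; lra.
    by move=> _; exists (l + 1); rewrite ?ltrDl ?ltry.
  have [r r0 hr] := potential_lsc lP'.
  exists r => //; apply: (@off _ l l') => //; first exact: open_disk.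
  by move=> x /hr/ltW.
Qed.
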